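(* Let $\Sigma,\Gamma$ be finite alphabets and let $\mathcal{A}$ be a game automaton over trees with alphabet $\Sigma\times\Gamma$. Let $\forall^{\ast}L(\mathcal{A})\subseteq T_\Sigma$ be the set of trees $t\in T_\Sigma$ such that the set $\{t'\in T_\Gamma\mid (t,t')\in L(\mathcal{A})\}$ is comeager in $T_\Gamma$. Then $\forall^{\ast}L(\mathcal{A})$ is regular, and one can effectively construct an alternating Muller tree automaton $\mathcal{B}$ over $\Sigma$ with $L(\mathcal{B})=\forall^{\ast}L(\mathcal{A})$, whose size is polynomial in the size of $\mathcal{A}$.
   Context: For a finite alphabet $\Sigma$, $T_\Sigma$ denotes the set of functions $\{\mathtt{L},\mathtt{R}\}^\ast\to\Sigma$ (labellings of the full binary tree, whose vertices are finite words over $\{\mathtt{L},\mathtt{R}\}$, the root being the empty word and $w$ having children $w\mathtt{L},w\mathtt{R}$), endowed with the product topology (homeomorphic to the Cantor space). A pair $(t,t')$ is identified with the tree over $\Sigma\times\Gamma$ with labels $(t(u),t'(u))$. An alternating Muller tree automaton over $\Sigma$ is $\mathcal{A}=(\Sigma,Q,q_I,\delta,\mathcal{F})$ with $Q$ finite, $q_I\in Q$, $\delta:Q\times\Sigma\to\mathcal{DL}(\{\mathtt{L},\mathtt{R}\}\times Q)$ where $\mathcal{DL}(X)$ is the set of expressions built from elements of $X$ with $\wedge,\vee$, and $\mathcal{F}\subseteq\mathcal{P}(Q)$. A tree $t$ is accepted iff Player $\exists$ wins the acceptance game: it starts at $\langle\epsilon,q_I\rangle$; from $\langle u,q\rangle$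 the game moves to $\langle u,\delta(q,t(u))\rangle$; at $\langle u,e_1\vee e_2\rangle$ Player $\exists$ chooses $e_1$ or $e_2$, at $\langle u,e_1\wedge e_2\rangle$ Player $\forall$ chooses; at $\langle u,(d,q)\rangle$ the game moves to $\langle ud,q\rangle$; an infinite play is won by $\exists$ iff the set of states $q$ occurring infinitely often in configurations $\langle u,q\rangle$ belongs to $\mathcal{F}$. $L(\mathcal{A})$ is the set of accepted trees. $\mathcal{A}$ is a game automaton if every transition $\delta(q,a)$ is of the form $(\mathtt{L},q_{\mathtt{L}})\mathbin{\chi}(\mathtt{R},q_{\mathtt{R}})$ with $\chi\in\{\vee,\wedge\}$. A set of trees is regular if it is recognised by an alternating (equivalently, nondeterministic) Muller tree automaton, equivalently definable in monadic second-order logic of the full binary tree. *)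

(* Defs.v *)
From HB Require Import structures.
From mathcomp Require Import all_boot all_order all_algebra.
From mathcomp Require Import boolp classical_sets functions cardinality topology.

Set Implicit Arguments.
Unset Strict Implicit.
Unset Printing Implicit Defensive.

Local Open Scope classical_set_scope.

(** Words over {L, R} are boolean sequences; the root is [::] and the children of
    u are [rcons u dirL] and [rcons u dirR]. *)
Notation dirL := false (only parsing).
Notation dirR := true (only parsing).
Notation word := (seq bool) (only parsing).

Definition tree (S : choiceType) : Type :=
  prod_topology (fun _ : word => discrete_topology S).

HB.instance Definition _ (S : choiceType) := Topological.on (tree S).

Definition pair_tree (S G : choiceType) (t : tree S) (t' : tree G) :
  tree (S * G)%type := fun u => (t u, t' u).

Definition nowhere_dense (T : topologicalType) (A : set T) :=
  interior (closure A) = set0.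

Definition meager (T : topologicalType) (A : set T) :=
  exists F : nat -> set T,
    (forall n, nowhere_dense (F n)) /\ A = \bigcup_n F n.

Definition comeager (T : topologicalType) (A : set T) := meager (~` A).

Definition forall_star (S G : choiceType) (X : set (tree (S * G)%type)) :
  set (tree S) := [set t | comeager [set t' : tree G | X (pair_tree t t')]].

Inductive dl (X : Type) :=
| Atom of X
| And of dl X & dl X
| Or of dl X & dl X.

Fixpoint dl_size (X : Type) (e : dl X) : nat :=
  match e with
  | Atom _ => 1
  | And e1 e2 | Or e1 e2 => (dl_size e1 + dl_size e2).+1
  end.

(** Alternating Muller tree automata over the alphabet S. *)
Record aut (S : Type) := Aut {
  state : finType;
  init : state;
  trans : state -> S -> dl (bool * state);
  acc : {set {set state}}
}.

Definition game_aut (S : Type) (A : aut S) :=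
  forall (q : state A) (a : S), exists qL qR : state A,
    trans q a = And (Atom (dirL, qL)) (Atom (dirR, qR)) \/
    trans q a = Or (Atom (dirL, qL)) (Atom (dirR, qR)).

Section AcceptanceGame.
Variables (S : choiceType) (A : aut S) (t : tree S).

Inductive config :=
| Pos of word & state A
| Expr of word & dl (bool * state A).

Inductive move : config -> config -> Prop :=
| MoveRead u q : move (Pos u q) (Expr u (trans q (t u)))
| MoveAtom u d q : move (Expr u (Atom (d, q))) (Pos (rcons u d) q)
| MoveAndL u e1 e2 : move (Expr u (And e1 e2)) (Expr u e1)
| MoveAndR u e1 e2 : move (Expr u (And e1 e2)) (Expr u e2)
| MoveOrL u e1 e2 : move (Expr u (Or e1 e2)) (Expr u e1)
| MoveOrR u e1 e2 : move (Expr u (Or e1 e2)) (Expr u e2).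

(** All plays are infinite, since every configuration has a successor. *)
Definition play (pi : nat -> config) :=
  pi 0 = Pos [::] (init A) /\ forall n, move (pi n) (pi n.+1).

(** A strategy of the existential player looks at the play so far, current
    configuration included, and tells whether to take the left disjunct; its
    value is irrelevant when the current configuration is not a disjunction. *)
Definition strategy := seq config -> bool.

Definition follows (sigma : strategy) (pi : nat -> config) :=
  forall n u e1 e2, pi n = Expr u (Or e1 e2) ->
    pi n.+1 = Expr u (if sigma (mkseq pi n.+1) then e1 else e2).

Definition inf_states (pi : nat -> config) : {set state A} :=
  [set q | `[< infinite_set [set n | exists u, pi n = Pos u q] >]]%SET.

Definition accepts :=
  exists sigma : strategy, forall pi, play pi -> follows sigma pi ->
    inf_states pi \in acc A.

End AcceptanceGame.

Definition lang (S : choiceType) (A : aut S) : set (tree S) :=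
  [set t | accepts A t].

Definition regular (S : choiceType) (X : set (tree S)) :=
  exists B : aut S, lang B = X.

(** ** Finite presentations and size

    The family [acc A] of sets of states is presented by a propositional formula
    whose variables are the states: the sets in the family are the valuations
    that satisfy it. *)
Inductive bform (Q : Type) :=
| BVar of Q
| BNot of bform Q
| BAnd of bform Q & bform Q
| BOr of bform Q & bform Q.

Fixpoint beval (Q : finType) (X : {set Q}) (phi : bform Q) : bool :=
  match phi with
  | BVar q => q \in X
  | BNot f => ~~ beval X f
  | BAnd f g => beval X f && beval X g
  | BOr f g => beval X f || beval X g
  end.

Definition describes (Q : finType) (phi : bform Q) (F : {set {set Q}}) :=
  forall X : {set Q}, (X \in F) = beval X phi.

(** Every family has such a presentation; the state q0 only serves to write the
    two constants. *)
Lemma describes_exists (Q : finType) (q0 : Q) (F : {set {set Q}}) :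
  exists phi : bform Q, describes phi F.
Proof.
pose lit (X : {set Q}) q := if q \in X then BVar q else BNot (BVar q).
pose char (X : {set Q}) :=
  foldr (fun q f => BAnd (lit X q) f) (BOr (BVar q0) (BNot (BVar q0))) (enum Q).
exists (foldr (fun X f => BOr (char X) f) (BAnd (BVar q0) (BNot (BVar q0)))
              (enum F)) => Y.
have litE X q : beval Y (lit X q) = ((q \in Y) == (q \in X)).
  by rewrite /lit; case: (q \in X) => /=; case: (q \in Y).
have charE X : beval Y (char X) = (Y == X).
  have -> : (Y == X) = all (fun q => (q \in Y) == (q \in X)) (enum Q).
    apply/eqP/allP => [-> q _|YX]; first exact: eqxx.
    by apply/setP => q; apply/eqP/YX; rewrite mem_enum.
  rewrite /char; elim: (enum Q) => [|q s IHs] /=; first exact: orbN.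
  by rewrite litE IHs.
rewrite -mem_enum; elim: (enum F) => [|X s IHs] /=; first by rewrite andbN.
by rewrite inE charE IHs.
Qed.

Fixpoint bform_size (Q : Type) (phi : bform Q) : nat :=
  match phi with
  | BVar _ => 1
  | BNot f => (bform_size f).+1
  | BAnd f g | BOr f g => (bform_size f + bform_size g).+1
  end.

(** Size of the transition graph: states and transition expressions. *)
Definition graph_size (S : finType) (A : aut S) : nat :=
  #|state A| + \sum_(q : state A) \sum_(a : S) dl_size (trans q a).

Definition aut_size (S : finType) (A : aut S) (phi : bform (state A)) : nat :=
  graph_size A + bform_size phi.

(** ** Effectiveness

    The model of computation is the WHILE language on binary trees (N. D. Jones,
    "Computability and Complexity"), which is Turing complete, with a single
    store passed from one command to the next instead of named variables. *)
Inductive data := Nil | Cons of data & data.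

Definition fst_data (d : data) := if d is Cons x _ then x else Nil.
Definition snd_data (d : data) := if d is Cons _ y then y else Nil.

Inductive prog :=
| PId
| PNil
| PFst
| PSnd
| PCons of prog & prog
| PSeq of prog & prog
| PIf of prog & prog & prog
| PWhile of prog & prog.

(** [run P x y]: on input x, the program P halts with output y. *)
Inductive run : prog -> data -> data -> Prop :=
| RunId x : run PId x x
| RunNil x : run PNil x Nil
| RunFst x : run PFst x (fst_data x)
| RunSnd x : run PSnd x (snd_data x)
| RunCons f g x y z : run f x y -> run g x z -> run (PCons f g) x (Cons y z)
| RunSeq f g x y z : run f x y -> run g y z -> run (PSeq f g) x z
| RunIfNil c f g x y : run c x Nil -> run g x y -> run (PIf c f g) x y
| RunIfCons c f g x a b y :
    run c x (Cons a b) -> run f x y -> run (PIf c f g) x y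
| RunWhileNil c f x : run c x Nil -> run (PWhile c f) x x
| RunWhileCons c f x a b y z :
    run c x (Cons a b) -> run f x y -> run (PWhile c f) y z ->
    run (PWhile c f) x z.

Definition code_nat (n : nat) : data := iter n (Cons Nil) Nil.

Definition code_seq (s : seq data) : data := foldr Cons Nil s.

Definition code_state (Q : finType) (q : Q) : data := code_nat (enum_rank q).

Fixpoint code_dl (Q : finType) (e : dl (bool * Q)) : data :=
  match e with
  | Atom (d, q) =>
      code_seq [:: code_nat 0; code_nat (nat_of_bool d); code_state q]
  | And e1 e2 => code_seq [:: code_nat 1; code_dl e1; code_dl e2]
  | Or e1 e2 => code_seq [:: code_nat 2; code_dl e1; code_dl e2]
  end.

Fixpoint code_bform (Q : finType) (phi : bform Q) : data :=
  match phi with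
  | BVar q => code_seq [:: code_nat 0; code_state q]
  | BNot f => code_seq [:: code_nat 1; code_bform f]
  | BAnd f g => code_seq [:: code_nat 2; code_bform f; code_bform g]
  | BOr f g => code_seq [:: code_nat 3; code_bform f; code_bform g]
  end.

(** The argument [letters] enumerates the alphabet and fixes the order of the
    columns of the transition table. *)
Definition code_aut (S : Type) (letters : seq S) (A : aut S)
    (phi : bform (state A)) : data :=
  code_seq
    [:: code_nat #|state A|;
        code_state (init A);
        code_seq [seq code_seq [seq code_dl (trans q a) | a <- letters]
                 | q <- enum (state A)];
        code_bform phi].

Definition code_input (S G : finType) (A : aut (S * G)%type)
    (phi : bform (state A)) : data :=
  code_seq
    [:: code_nat #|S|;
        code_nat #|G|;
        code_aut [seq (a, b) | a <- enum S, b <- enum G] phi].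

Definition code_output (S : finType) (B : aut S) (psi : bform (state B)) :
  data := code_aut (enum S) psi.

(* Main.v *)
Require Import Defs.
From HB Require Import structures.
From mathcomp Require Import all_boot all_order all_algebra.
From mathcomp Require Import boolp classical_sets functions cardinality topology.
From mathcomp Require Import zify.
(* [seq] shadows the constructors [Nil] and [Cons] of [data]. *)
Import Defs.

(** The category game. The automaton for [forall_star (lang A)] has states
    [(c, q)] where the player [c] (the existential one if [c = true]) is in
    control of the letters of [G]: at each vertex he chooses the letter [b] and
    who is in control next, and then the players choose a direction as in the
    acceptance game of [A] on [(a, b)]. A player who keeps the control forever
    loses; otherwise the winner is the one of [A]. This is a Banach-Mazur game
    played along one branch, the universal player moving first.

    Suppose that [P] wins it and let [n] be a node of his strategy at which the
    opponent is in control. For an open dense set of trees [t'], if the letters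
    of the opponent are read off [t'], [P] can let the opponent pass at a moment
    such that in the phase of [P] that follows, which is finite by Koenig's
    lemma, the letters chosen by [P] are also those of [t'] ([reach_generic]).
    There are countably many nodes, so that this holds at all of them for
    comeagerly many [t'], and then [P] wins the game of [A] on [(t, t')] by
    simulating alternating phases. Hence if the existential player wins then
    [t] is in [forall_star (lang A)]. If the universal player wins, his first
    phase determines an open set in which [t'] is generically rejected, so by
    Baire's theorem [t] is not in [forall_star (lang A)]. Determinacy of Muller
    games concludes. *)

Set Implicit Arguments.
Unset Strict Implicit.
Unset Printing Implicit Defensive.

Local Open Scope nat_scope.

(** * Determinacy of Muller games *)

Lemma existT_inj (I : Type) (T : I -> Type) i (x y : T i) :
  existT T i x = existT T i y -> x = y.
Proof.
move=> e; have := projT2_eq e.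
by rewrite (Prop_irrelevance (projT1_eq e) erefl).
Qed.

Section InfSet.
Variable C : finType.
Implicit Types rho : nat -> C.

Definition inf_set rho : {set C} :=
  [set c | `[< forall n, exists2 m, n <= m & rho m = c >]]%SET.

Lemma inf_setP rho c :
  reflect (forall n, exists2 m, n <= m & rho m = c) (c \in inf_set rho).
Proof. by rewrite inE; apply: asboolP. Qed.

(** Prefix independence of the Muller condition, which allows strategies to be switched during a
    play. *)
Lemma inf_set_shift rho k : inf_set (fun i => rho (k + i)) = inf_set rho.
Proof.
apply/setP => c; apply/inf_setP/inf_setP => H n.
  by have [m nm <-] := H n; exists (k + m) => //; rewrite (leq_trans nm) ?leq_addl.
have [m nm <-] := H (k + n); exists (m - k); first by rewrite leq_subRL // (leq_trans _ nm) ?leq_addr.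
by rewrite subnKC // (leq_trans _ nm) ?leq_addr.
Qed.

End InfSet.

(** * Games given by a forcing relation, with strategies as graphs *)

Section Games.
Variables (V : Type) (C : finType) (col : V -> C) (F : {set {set C}}).
(** [force P v X] stands for: in one round from [v], player [P] can make the next vertex lie in [X].
    A round may involve choices of both players. *)
Variable force : bool -> V -> (V -> Prop) -> Prop.
Hypothesis force_mono : forall P v (X Y : V -> Prop),
  (forall w, X w -> Y w) -> force P v X -> force P v Y.
Hypothesis force_dual : forall P v (X : V -> Prop),
  ~ force P v X -> force (~~ P) v (fun w => ~ X w).

Definition won P (rho : nat -> C) := (inf_set rho \in F) = P.

(** A strategy with arbitrary memory, the nodes being its memory states. Reaching [X] counts as
    success, so [path_won] only concerns plays that never stop. *)
Record sgraph (Z X : V -> Prop) (P : bool) := SGraph {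
  node : Type;
  edge : node -> node -> Prop;
  lab : node -> V;
  lab_in : forall n, Z (lab n);
  lab_force : forall n,
    force P (lab n) (fun v => X v \/ exists2 n', edge n n' & lab n' = v);
  path_won : forall rho : nat -> node, (forall i, edge (rho i) (rho i.+1)) ->
    won P (fun i => col (lab (rho i)))
}.

Definition wins Z X P v :=
  exists (g : sgraph Z X P) (n : node g), lab n = v.

Section Sum.
Variables (I : Type) (Z X : I -> V -> Prop) (Z' X' : V -> Prop) (P : bool).
Variable g : forall i, sgraph (Z i) (X i) P.

Definition sum_node := {i : I & node (g i)}.
Definition sum_lab (a : sum_node) := lab (projT2 a).
Definition sum_edge (a b : sum_node) :=
  exists i n n', [/\ a = existT _ i n, b = existT _ i n' & edge n n'].

Lemma sum_edge_idx a b : sum_edge a b -> projT1 b = projT1 a.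
Proof. by case=> i [n [n' [-> -> _]]]. Qed.

Lemma sum_path_won (rho : nat -> sum_node) :
  (forall i, sum_edge (rho i) (rho i.+1)) ->
  won P (fun i => col (sum_lab (rho i))).
Proof.
move=> Hrho.
have [i /choice [r Hr]] : exists i, forall k, exists n, rho k = existT _ i n.
  case E0 : (rho 0) => [i n]; exists i; elim=> [|k [m IHk]]; first by exists n.
  case: (Hrho k) => j [p [p' [Hp Hp' _]]]; move: Hp; rewrite IHk => - [Hij].
  by subst j; exists p'.
have -> : (fun k => col (sum_lab (rho k))) = (fun k => col (lab (r k))).
  by apply/funext => k; rewrite Hr.
apply: path_won => k; case: (Hrho k) => j [p [p' []]].
rewrite !Hr => Hp Hp'; have Hij : i = j by case: Hp.
move: p p' Hp Hp'; rewrite -Hij => p p'.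
by move=> Hp Hp'; rewrite (existT_inj Hp) (existT_inj Hp').
Qed.

Lemma sum_force (a : sum_node) :
  force P (sum_lab a)
    (fun v => X (projT1 a) v \/ exists2 b, sum_edge a b & sum_lab b = v).
Proof.
case: a => i n; apply: force_mono (lab_force n) => v [Xv|[n' En <-]].
  by left.
by right; exists (existT _ i n') => //; exists i, n, n'.
Qed.

End Sum.

(** The disjoint union of strategies chosen for each vertex of [W] serves them all; a path never
    leaves its summand. *)
Lemma wins_union (W Z X : V -> Prop) P :
  (forall v, W v -> wins Z X P v) ->
  exists g : sgraph Z X P, forall v, W v -> exists n : node g, lab n = v.
Proof.
move=> HW.
have /choice [f Hf] : forall v : {v | W v},
    exists g : sgraph Z X P, exists n : node g, lab n = sval v.
  by case=> v Wv; have [g [n Hn]] := HW v Wv; exists g, n.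
have labin (a : sum_node f) : Z (sum_lab a) by apply: lab_in.
exists (SGraph labin (@sum_force _ _ _ _ f) (@sum_path_won _ _ _ _ f)) => v Wv.
have [n Hn] := Hf (exist _ v Wv).
by exists (existT _ (exist _ v Wv) n).
Qed.

Lemma won_shift P rho k : won P (fun i => rho (k + i)) -> won P rho.
Proof. by rewrite /won inf_set_shift. Qed.

(** Follow [g] until it exits into [W], then a strategy from there. The switch happens at most once,
    so a tail of the play lies in one graph and decides the winner. *)
Lemma wins_compose (Z1 Z X W : V -> Prop) P
    (g : sgraph Z1 (fun v => X v \/ W v) P) :
  (forall v, Z1 v -> Z v) -> (forall v, W v -> wins Z X P v) ->
  forall n : node g, wins Z X P (lab n).
Proof.
move=> Z1Z /wins_union [h Hh].
pose N := (node g + node h)%type.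
pose l (a : N) := match a with inl n => lab n | inr n => lab n end.
pose E (a b : N) := match a, b with
  | inl n, inl n' => edge n n' | inr n, inr n' => edge n n'
  | inl _, inr _ => True | _, _ => False end.
have lin a : Z (l a) by case: a => n /=; [apply/Z1Z|]; apply: lab_in.
have lf a : force P (l a) (fun v => X v \/ exists2 b, E a b & l b = v).
  case: a => n /=; apply: force_mono (lab_force n) => v.
    case=> [[|/Hh [m <-]]|[m]]; [by left| by right; exists (inr m)|].
    by right; exists (inl m).
  by case=> [|[m]]; [left|right; exists (inr m)].
have lw rho : (forall i, E (rho i) (rho i.+1)) -> won P (fun i => col (l (rho i))).
  move=> Hrho; have [[k [m Hk]]|Hn] := pselect (exists k m, rho k = inr m).
    have /choice [r Hr] : forall i, exists n, rho (k + i) = inr n.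
      elim=> [|i [n Hi]]; first by exists m; rewrite addn0.
      have := Hrho (k + i); rewrite Hi -addnS.
      by case: (rho (k + i.+1)) => // n' _; exists n'.
    apply: (@won_shift _ _ k).
    have -> : (fun i => col (l (rho (k + i)))) = (fun i => col (lab (r i))).
      by apply/funext => i; rewrite Hr.
    by apply: path_won => i; have := Hrho (k + i); rewrite -addnS !Hr.
  have /choice [r Hr] : forall i, exists n, rho i = inl n.
    move=> i; case Ei : (rho i) => [n|n]; first by exists n.
    by case: Hn; exists i, n.
  have -> : (fun i => col (l (rho i))) = (fun i => col (lab (r i))).
    by apply/funext => i; rewrite Hr.
  by apply: path_won => i; have := Hrho i; rewrite !Hr.
by move=> n; exists (SGraph lin lf lw), (inl n).
Qed.

Lemma wins_step (Z X W : V -> Prop) P u :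
  Z u -> (forall v, W v -> wins Z X P v) ->
  force P u (fun v => X v \/ W v) -> wins Z X P u.
Proof.
move=> Zu HW Hu.
have f1 (n : unit) : force P u (fun v => (X v \/ W v) \/
    exists2 n' : unit, False & u = v).
  by apply: force_mono Hu => v; left.
have f2 (rho : nat -> unit) : (forall i : nat, False) -> won P (fun=> col u).
  by move=> /(_ 0).
exact: (@wins_compose Z Z X W P (SGraph (fun=> Zu) f1 f2) _ HW tt).
Qed.

Section Cycle.
Variables (D : {set C}) (P : bool) (Z U X : V -> Prop).
Hypotheses (UZ : forall v, U v -> Z v) (UD : forall v, U v -> col v \in D).
Hypothesis DP : (D \in F) = P.
Hypothesis U_force : forall v, U v -> force P v (fun w => X w \/ U w).
Hypothesis U_sub : forall c, c \in D -> forall v, U v -> col v <> c ->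
  wins (fun w => U w /\ col w <> c) (fun w => X w \/ (U w /\ col w = c)) P v.

(* The player looks for the colours of [D] one after the other, cyclically: in
   phase [i] he follows a strategy winning against all plays that avoid the
   colour [cs i], and passes to the next phase as soon as [cs i] shows up. *)
Lemma wins_cycle v : U v -> wins Z X P v.
Proof.
move=> Uv; pose cs i := nth (col v) (enum D) (i %% size (enum D)).
have D0 : 0 < size (enum D).
  by rewrite -cardE; apply/card_gt0P; exists (col v); apply: UD.
have csD i : cs i \in D by rewrite -mem_enum mem_nth // ltn_mod.
have csE c k : c \in D -> exists2 i, k <= i & cs i = c.
  move=> cD; exists (k * size (enum D) + index c (enum D)).
    by rewrite (leq_trans _ (leq_addr _ _)) // leq_pmulr.
  rewrite /cs modnMDl modn_small ?nth_index ?mem_enum //.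
  by rewrite index_mem mem_enum.
pose Zi i w := U w /\ col w <> cs i.
pose Xi i w := X w \/ (U w /\ col w = cs i).
have Hg i : exists g : sgraph (Zi i) (Xi i) P,
    forall w, Zi i w -> exists n : node g, lab n = w.
  by apply: wins_union => w [Uw cw]; apply: U_sub (csD i) _ Uw cw.
pose g i := sval (cid (Hg i)).
have gP i w : Zi i w -> exists n : node (g i), lab n = w.
  exact: (svalP (cid (Hg i)) w).
(* A node of [M] is a vertex of colour [cs i] met in phase [i]; leaving it starts phase [i.+1]. *)
pose M := {iw : nat * V | U iw.2 /\ col iw.2 = cs iw.1}.
pose N := (sum_node g + M)%type.
pose l (a : N) := match a with inl a => sum_lab a | inr m => (sval m).2 end.
pose idx (a : N) := match a with inl a => projT1 a | inr m => (sval m).1 end.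
pose ism (a : N) := if a is inr _ then true else false.
pose E (a b : N) := match a, b with
  | inl n, inl n' => sum_edge n n'
  | _, _ => idx b = ism a + idx a end.
have Eidx a b : E a b -> idx b = ism a + idx a.
  by case: a b => [a|a] [b|b] //= /sum_edge_idx ->.
have startP i w : U w -> exists2 b : N, idx b = i & l b = w.
  move=> Uw; have [cw|cw] := pselect (col w = cs i).
    by exists (inr (exist _ (i, w) (conj Uw cw))).
  have [n Hn] := gP i w (conj Uw cw).
  by exists (inl (existT _ i n)).
have lU a : U (l a).
  case: a => [[i n]|[[i w] []]] //=; rewrite /sum_lab /=.
  by have [] := lab_in n.
have lf a : force P (l a) (fun v => X v \/ exists2 b, E a b & l b = v).
  case: a => [a|m] /=.
    apply: force_mono (sum_force a) => w [[Xw|[Uw cw]]|[b Eb <-]].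
    - by left.
    - by right; exists (inr (exist _ (projT1 a, w) (conj Uw cw))).
    - by right; exists (inl b).
  have := U_force (lU (inr m)); apply: force_mono => w [|Uw]; first by left.
  right; have [b Hb <-] := startP (sval m).1.+1 w Uw.
  by exists b => //; case: b Hb.
have lw rho : (forall i, E (rho i) (rho i.+1)) -> won P (fun i => col (l (rho i))).
  move=> Hrho.
  (* If phases stop changing, a tail follows one winning sub-strategy. Otherwise every phase is
     completed, and the colours seen infinitely often are exactly [D]. *)
  have [[k Hk]|Hinf] := pselect (exists k, forall j, ~~ ism (rho (k + j))).
    apply: (@won_shift _ _ k).
    have /choice [r Hr] : forall i, exists n, rho (k + i) = inl n.
      by move=> i; have := Hk i; case: (rho (k + i)) => // n _; exists n.
    have -> : (fun i => col (l (rho (k + i)))) = (fun i => col (sum_lab (r i))).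
      by apply/funext => i; rewrite Hr.
    apply: sum_path_won => i; have := Hrho (k + i).
    by rewrite -addnS !Hr.
  have next k : exists2 m, k <= m & ism (rho m) /\ idx (rho m) = idx (rho k).
    have [j Hj] : exists j, ism (rho (k + j)).
      apply: contrapT => Hj; apply: Hinf; exists k => j.
      by apply/negP => Hkj; apply: Hj; exists j.
    elim: j k Hj => [|j IHj] k Hj; first by rewrite addn0 in Hj; exists k.
    case Hk : (ism (rho k)); first by exists k.
    rewrite addnS -addSn in Hj; have [m km [Hm Em]] := IHj _ Hj.
    by exists m; [exact: ltnW|split; rewrite // Em (Eidx _ _ (Hrho k)) Hk].
  have reach j k : exists2 m, k <= m & ism (rho m) /\ idx (rho m) = idx (rho k) + j.
    elim: j => [|j [m km [Hm Em]]]; first by rewrite addn0.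
    have [m' mm' [Hm' Em']] := next m.+1.
    exists m'; first by rewrite (leq_trans km) // ltnW.
    by split; rewrite // Em' (Eidx _ _ (Hrho m)) Hm Em addnS.
  rewrite /won; suff -> : inf_set (fun i => col (l (rho i))) = D by [].
  apply/setP => c; apply/inf_setP/idP => [/(_ 0) [m _ <-]|cD k].
    exact: UD.
  have [i ki ci] := csE c (idx (rho k)) cD.
  have [m km [Hm Em]] := reach (i - idx (rho k)) k.
  exists m => //; move: Hm Em; rewrite subnKC // => Hm Em.
  case: (rho m) Hm Em => // - [[j w] [/= Uw cw]] _ /= ij.
  by rewrite cw ij ci.
have [b _ Hb] := startP 0 v Uv.
have lZ a : Z (l a) by apply/UZ/lU.
by exists (SGraph lZ lf lw), b.
Qed.

End Cycle.

(** Induction on the number of colours. [ex b] holds the exits good for [b], and [P] is the player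
    who wins if all of [D] recurs. Outside the winning region [W] of the opponent, [P] wins by
    cycling through [D]. *)
Lemma determined_in (D : {set C}) (Z : V -> Prop) (ex : bool -> V -> Prop) :
  (forall P v, Z v \/ ex P v \/ ex (~~ P) v) -> (forall v, Z v -> col v \in D) ->
  forall v, Z v -> exists P, wins Z (ex P) P v.
Proof.
move: {2}#|D| (leqnn #|D|) => k; elim: k D Z ex => [|k IHk] D Z ex Dk Hcov ZD v Zv.
  by move: (ZD v Zv); move: Dk; rewrite leqn0 cards_eq0 => /eqP ->; rewrite inE.
pose P := D \in F; pose W w := Z w /\ wins Z (ex (~~ P)) (~~ P) w.
pose U w := Z w /\ ~ wins Z (ex (~~ P)) (~~ P) w.
have [Hv|Hv] := pselect (wins Z (ex (~~ P)) (~~ P) v); first by exists (~~ P).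
exists P; apply: (@wins_cycle D P Z U (ex P)) => // [w []//|w [/ZD//]||].
(* If [P] could not force his exits or [U], by duality the opponent could force his own exits or
   [W], and would win from [w]. *)
- move=> w [Zw Hw]; apply: contrapT => /force_dual Hf; apply: Hw.
  apply: (@wins_step Z _ W) => // [x []//|].
  apply: force_mono Hf => x Hx; case: (Hcov P x) => [Zx|[ePx|]]; last by left.
    right; split=> //; apply: contrapT => Hn; apply: Hx; by right.
  by case: Hx; left.
- move=> c cD w [Zw Hw] cw.
  (* In the subgame that avoids [c], meeting [c] inside [U] is an exit for [P], and entering [W] is
     one for the opponent. *)
  pose ex' (b : bool) x := if b == P then ex P x \/ (U x /\ col x = c) else
     ex (~~ P) x \/ W x.
  have [||||b] := IHk (D :\ c)%SET (fun x => U x /\ col x <> c) ex' _ _ _ w _.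
  + by move: Dk; rewrite (cardsD1 c) cD ltnS.
  + have H x : (U x /\ col x <> c) \/ (ex P x \/ (U x /\ col x = c)) \/
        (ex (~~ P) x \/ W x).
      case: (Hcov P x) => [Zx|]; last by tauto.
      have := pselect (wins Z (ex (~~ P)) (~~ P) x).
      have := pselect (col x = c); rewrite /U /W; tauto.
    move=> b x; have := H x; rewrite /ex' -[in ~~ b == P]addTb.
    by case: (b) (P) => [] [] /=; tauto.
  + by move=> x [[/ZD Dx _] cx]; rewrite !inE Dx andbT; apply/eqP.
  + by [].
  rewrite /ex'; case: eqP => [->//|/eqP bP].
  have -> : b = ~~ P by move: bP; case: (b) (P) => [] [].
  (* Were the subgame won by the opponent, going on with his strategies on [W] would make him win
     from [w]. *)
  case=> g [n Hn]; case: Hw; rewrite -Hn.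
  by apply: (@wins_compose _ Z (ex (~~ P)) W _ g) => [x [[]]|x []].
Qed.

Theorem determinacy v : exists P, wins (fun=> True) (fun=> False) P v.
Proof.
apply: (@determined_in [set: C]%SET (fun=> True) (fun _ _ => False)) => //.
  by move=> P w; left.
Qed.

End Games.

(** * Acceptance games *)

(** Player [P] can resolve [e] so as to end at an atom in [Y]; the existential player owns [Or], the
    other one [And]. *)
Fixpoint fdl (X : Type) (P : bool) (e : dl X) (Y : X -> Prop) : Prop :=
  match e with
  | Atom x => Y x
  | And e1 e2 => if P then fdl P e1 Y /\ fdl P e2 Y else fdl P e1 Y \/ fdl P e2 Y
  | Or e1 e2 => if P then fdl P e1 Y \/ fdl P e2 Y else fdl P e1 Y /\ fdl P e2 Y
  end.

Lemma fdl_mono (X : Type) P (e : dl X) (Y Z : X -> Prop) :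
  (forall x, Y x -> Z x) -> fdl P e Y -> fdl P e Z.
Proof.
move=> YZ; elim: e => /= [x|e1 H1 e2 H2|e1 H1 e2 H2]; first exact: YZ.
  by case: P H1 H2; tauto.
by case: P H1 H2; tauto.
Qed.

Lemma fdl_dual (X : Type) P (e : dl X) (Y : X -> Prop) :
  ~ fdl P e Y -> fdl (~~ P) e (fun x => ~ Y x).
Proof.
elim: e => //= e1 H1 e2 H2; case: P H1 H2 => /= H1 H2.
- by move/not_andP; tauto.
- by move/not_orP; tauto.
- by move/not_orP; tauto.
- by move/not_andP; tauto.
Qed.

Section Acceptance.
Variables (S : choiceType) (A : aut S) (t : tree S).
Let V := (seq bool * state A)%type.

(** A round leads from one position to the next; the expressions in between are absorbed by
    [fdl]. *)
Definition aforce (P : bool) (v : V) (X : V -> Prop) : Prop :=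
  fdl P (trans v.2 (t v.1)) (fun x => X (rcons v.1 x.1, x.2)).

Definition awins (P : bool) (v : V) :=
  wins snd (acc A) aforce (fun=> True) (fun=> False) P v.

Lemma aforce_mono P v (X Y : V -> Prop) :
  (forall w, X w -> Y w) -> aforce P v X -> aforce P v Y.
Proof. by move=> XY; apply: fdl_mono => x; apply: XY. Qed.

Lemma aforce_dual P v (X : V -> Prop) :
  ~ aforce P v X -> aforce (~~ P) v (fun w => ~ X w).
Proof. exact: fdl_dual. Qed.

Lemma awins_determined v : awins true v \/ awins false v.
Proof.
by have [[] Hv] := determinacy snd (acc A) aforce_mono aforce_dual v; [left|right].
Qed.


Definition child (b : bool) (c : config A) : config A :=
  match c with
  | Expr u (And e1 e2) | Expr u (Or e1 e2) => Expr u (if b then e1 else e2)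
  | Expr u (Atom (d, q)) => Pos (rcons u d) q
  | Pos u q => Expr u (trans q (t u))
  end.

Lemma moveP c c' : move t c c' <-> exists b, c' = child b c.
Proof.
split=> [[u q|u d q|u e1 e2|u e1 e2|u e1 e2|u e1 e2]|[b ->]].
- by exists true.
- by exists true.
- by exists true.
- by exists false.
- by exists true.
- by exists false.
by case: c => [u q|u [[d q]|e1 e2|e1 e2]] /=; case: b; constructor.
Qed.

Definition is_pos (c : config A) := if c is Pos _ _ then true else false.

(** * Plays that follow a strategy graph *)

Section Plays.
Variables (P : bool) (g : sgraph snd (acc A) aforce (fun=> True) (fun=> False) P).

Definition goal_from (n : node g) u (x : bool * state A) :=
  exists2 n', edge n n' & lab n' = (rcons u x.1, x.2).

Definition follow_node (n : node g) (c : config A) : node g :=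
  match c with
  | Pos u q => match pselect (exists2 n', edge n n' & lab n' = (u, q)) with
               | left H => s2val (cid2 H)
               | right _ => n
               end
  | Expr _ _ => n
  end.

Definition owned (c : config A) :=
  match c with
  | Expr _ (And _ _) => ~~ P
  | Expr _ (Or _ _) => P
  | _ => false
  end.

(** Takes the left operand whenever it still lets [P] force an edge of the graph; at an expression
    good for [P] and owned by him, the right one does otherwise. *)
Definition choose_left (n : node g) (c : config A) : bool :=
  match c with
  | Expr u (And e1 _) | Expr u (Or e1 _) => `[< fdl P e1 (goal_from n u) >]
  | _ => false
  end.

Definition good_at (n : node g) (c : config A) :=
  match c with
  | Pos u q => lab n = (u, q)
  | Expr u e => fdl P e (goal_from n u)
  end.

Variables (pi : nat -> config A) (m : nat -> node g).
Hypothesis pi0 : pi 0 = Pos [::] (init A).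
Hypothesis piS : forall k, exists b, pi k.+1 = child b (pi k).
Hypothesis m0 : lab (m 0) = ([::], init A).
Hypothesis mS : forall k, m k.+1 = follow_node (m k) (pi k.+1).
Hypothesis pi_owned : forall k, owned (pi k) ->
  pi k.+1 = child (choose_left (m k) (pi k)) (pi k).

Lemma good_follow n u q : goal_from n u q ->
  good_at (follow_node n (Pos (rcons u q.1) q.2)) (Pos (rcons u q.1) q.2) /\
  edge n (follow_node n (Pos (rcons u q.1) q.2)).
Proof. by move=> /= Hg; case: pselect => // H'; case: (cid2 H'). Qed.

Lemma good k : good_at (m k) (pi k).
Proof.
elim: k => [|k IHk]; first by rewrite pi0.
have [b Hb] := piS k; rewrite mS; move: IHk (pi_owned (k := k)) Hb => /=.
case: (pi k) => [u q|u [[d q]|e1 e2|e1 e2]] /= Hk own Hb.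
- rewrite Hb; have := lab_force (m k); rewrite Hk; apply: fdl_mono => x [//|[n' En' ln']].
  by exists n'.
- by rewrite Hb; exact: (good_follow Hk).1.
- have [EP|EP] : P = true \/ P = false by case: (P); [left|right].
    by move: Hk; rewrite Hb EP /= EP; case: (b) => -[].
  by move: Hk; rewrite own EP //= EP; case: asboolP => // H1 [].
- have [EP|EP] : P = true \/ P = false by case: (P); [left|right].
    by move: Hk; rewrite own EP //= EP; case: asboolP => // H1 [].
  by move: Hk; rewrite Hb EP /= EP; case: (b) => -[].
Qed.

Lemma expr_end e u k : pi k = Expr u e ->
  exists j, [/\ k < j, is_pos (pi j) & forall i, k <= i < j -> ~~ is_pos (pi i)].
Proof.
have step k' j : is_pos (pi k') = false ->
    [/\ k' < j, is_pos (pi j) & forall i, k'.+1 <= i < j -> ~~ is_pos (pi i)] ->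
    [/\ k' < j, is_pos (pi j) & forall i, k' <= i < j -> ~~ is_pos (pi i)].
  move=> pk [kj pj Hj]; split=> // i.
  by rewrite leq_eqVlt => /andP[/orP[/eqP<- _|ki ij]]; rewrite ?pk // Hj ?ki.
elim: e k => [[d q]|e1 IH1 e2 IH2|e1 IH1 e2 IH2] k Hk;
  have pk : is_pos (pi k) = false by rewrite Hk.
- have [b Hb] := piS k; exists k.+1; apply: step => //; split=> // [|i].
    by rewrite Hb Hk.
  by rewrite ltnS => /andP[ki]; rewrite leqNgt ki.
- have [[] Hb] := piS k; rewrite Hk /= in Hb.
    by have [j [kj pj Hj]] := IH1 _ Hb; exists j; apply: step => //; split=> //; exact: ltnW.
  by have [j [kj pj Hj]] := IH2 _ Hb; exists j; apply: step => //; split=> //; exact: ltnW.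
- have [[] Hb] := piS k; rewrite Hk /= in Hb.
    by have [j [kj pj Hj]] := IH1 _ Hb; exists j; apply: step => //; split=> //; exact: ltnW.
  by have [j [kj pj Hj]] := IH2 _ Hb; exists j; apply: step => //; split=> //; exact: ltnW.
Qed.

Lemma next_pos k : exists j, is_pos (pi k) ->
  [/\ k < j, is_pos (pi j) & forall i, k < i < j -> ~~ is_pos (pi i)].
Proof.
case Hk : (pi k) => [u q|u e]; last by exists 0.
have [b] := piS k; rewrite Hk /= => /expr_end [j [kj pj Hj]].
by exists j; split=> //; exact: ltnW.
Qed.

Lemma edge_between k j : is_pos (pi k) ->
  [/\ k < j, is_pos (pi j) & forall i, k < i < j -> ~~ is_pos (pi i)] ->
  edge (m k) (m j).
Proof.
move=> pk [kj pj Hj].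
have Hm i : k <= i < j -> m i = m k.
  elim: i => [|i IHi]; first by rewrite leqn0 => /andP[/eqP-> _].
  rewrite leq_eqVlt => /andP[/orP[/eqP<-//|ki ij]].
  rewrite mS -IHi; last by rewrite -ltnS ki ltnW.
  by have := Hj i.+1; rewrite ki ij => /(_ isT); case: (pi i.+1).
case: j kj pj Hj Hm => // j kj pj Hj Hm.
have jk : m j = m k by apply: Hm; rewrite -ltnS kj ltnSn.
have := good j; have [b] := piS j; have := mS j; rewrite jk => ->.
case: (pi j) => [u q|u [[d q]|e1 e2|e1 e2]] /= Hpi; move: pj; rewrite Hpi //= => _.
by move=> Hg; exact: (@good_follow _ _ (d, q) Hg).2.
Qed.

Lemma inf_statesP q :
  reflect (forall n, exists2 k, n <= k & exists u, pi k = Pos u q)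
          (q \in inf_states pi).
Proof.
rewrite inE; apply: (iffP (asboolP _)) => [Hinf n|H].
  apply: contrapT => Hn; apply: Hinf; apply: (sub_finite_set _ (finite_II n)) => k /= Hk.
  by rewrite ltnNge; apply/negP => nk; apply: Hn; exists k.
case/finite_seqP => s Hs.
have [k sk Hk] := H (\max_(i <- s) i).+1.
have : [set k | exists u, pi k = Pos u q]%classic k by [].
rewrite Hs /= => ks; move: sk; rewrite ltnNge => /negP; apply.
exact: (@leq_bigmax_seq _ s xpredT id).
Qed.

(** The nodes held at the times [tau i] when the play is at a position form a path of [g] labelled
    by these positions, so [path_won] applies. *)
Lemma play_won : (inf_states pi \in acc A) = P.
Proof.
have /choice [nx Hnx] := next_pos.
pose tau := fix tau i := if i is i'.+1 then nx (tau i') else 0.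
have ptau i : is_pos (pi (tau i)).
  by elim: i => [|i IHi] /=; [rewrite pi0|case: (Hnx _ IHi)].
have tauS i := Hnx _ (ptau i).
have tau_ge i : i <= tau i.
  by elim: i => // i IHi; case: (tauS i) => H _ _; exact: leq_ltn_trans H.
have tau_all k : is_pos (pi k) -> exists i, k = tau i.
  move=> pk; have [i] : exists i, tau i <= k < tau i.+1.
    elim: {pk} k => [|k [i]].
      by exists 0; rewrite leqnn /=; case: (tauS 0).
    case/andP=> ik; rewrite leq_eqVlt => /orP[/eqP ki|ki].
      by exists i.+1; rewrite ki leqnn; case: (tauS i.+1).
    by exists i; rewrite ki (leq_trans ik).
  case/andP; rewrite leq_eqVlt => /orP[/eqP<-|ik ki]; first by exists i.
  by case: (tauS i) => _ _ /(_ k); rewrite ik ki pk => /(_ isT).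
have Hw : won (acc A) P (fun i => (lab (m (tau i))).2).
  apply: (@path_won _ _ _ _ _ _ _ _ g (fun i => m (tau i))) => i.
  exact: edge_between (ptau i) (tauS i).
rewrite -[RHS]Hw; suff -> : inf_states pi = inf_set (fun i => (lab (m (tau i))).2) by [].
apply/setP => q.
have lq i u q' : pi (tau i) = Pos u q' -> (lab (m (tau i))).2 = q'.
  by move=> Hi; have := good (tau i); rewrite Hi /= => ->.
apply/inf_statesP/inf_setP => H n.
  have [k nk [u Hk]] := H (tau n).
  have [i Hi] : exists i, k = tau i by apply: tau_all; rewrite Hk.
  exists i; last by apply: (lq _ u); rewrite -Hi.
  rewrite leqNgt; apply/negP => ni; move: nk; rewrite leqNgt Hi => /negP; apply.
  rewrite -(subnK ni); elim: (n - i.+1) => [|j IHj]; first by case: (tauS i).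
  by apply: (ltn_trans IHj); rewrite addSn; case: (tauS (j + i.+1)).
have [i ni Hi] := H n; exists (tau i); first exact: leq_trans (tau_ge i).
case E : (pi (tau i)) (ptau i) => [u q'|//] _; exists u.
by rewrite (lq _ _ _ E) in Hi; rewrite Hi.
Qed.

End Plays.

Lemma awins_accepts : awins true ([::], init A) -> accepts A t.
Proof.
case=> g [n0 Hn0].
(* The memory is recomputed from the history; [behead] drops the initial configuration, which
   corresponds to [n0] itself. *)
pose mem (h : seq (config A)) := foldl (@follow_node true g) n0 (behead h).
pose c0 := Pos [::] (init A).
exists (fun h => choose_left (mem h) (last c0 h)) => pi [pi0 piS] Hpi.
pose m k := mem (mkseq pi k.+1).
apply: (@play_won true g pi m) => // [k|k|k].
- exact: (moveP _ _).1 (piS k).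
- by rewrite /m /mem [mkseq pi k.+2]mkseqS {1}/mkseq /= foldl_rcons.
- case E : (pi k) => [u q|u [[d q]|e1 e2|e1 e2]] //= _.
  rewrite (Hpi k u e1 e2 E); congr (Expr _ (if _ then _ else _)).
  by rewrite (_ : last c0 _ = Expr u (Or e1 e2)) // mkseqS last_rcons.
Qed.

Lemma awins_rejects : awins false ([::], init A) -> ~ accepts A t.
Proof.
case=> g [n0 Hn0] [sigma Hsigma].
pose c0 := Pos [::] (init A).
(* One step of the play of [sigma] against [g], carrying the history and the current node. *)
pose next (x : seq (config A) * node g) : seq (config A) * node g :=
  let c := last c0 x.1 in
  let b := if c is Expr _ (Or _ _) then sigma x.1 else choose_left x.2 c in
  (rcons x.1 (child b c), follow_node x.2 (child b c)).
pose st k := iter k next ([:: c0], n0).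
pose pi k := last c0 (st k).1; pose m k := (st k).2.
have piS k : pi k.+1 = child (if pi k is Expr _ (Or _ _) then
    sigma (st k).1 else choose_left (m k) (pi k)) (pi k).
  by rewrite {1}/pi {1}/st /= last_rcons.
have Hst k : (st k).1 = mkseq pi k.+1.
  elim: k => // k IHk; rewrite mkseqS -IHk piS.
  by rewrite {1}/st /=.
have Hpi k : pi k.+1 = child (if pi k is Expr _ (Or _ _) then
    sigma (mkseq pi k.+1) else choose_left (m k) (pi k)) (pi k).
  by rewrite -Hst piS.
have : (inf_states pi \in acc A) = false.
  apply: (@play_won false g pi m) => // [k|k|k].
  - by rewrite Hpi; eexists.
  - by rewrite piS.
  - by rewrite Hpi; case: (pi k) => [u q|u [[d q]|e1 e2|e1 e2]].
rewrite Hsigma //; first by split=> // k; apply/moveP; rewrite Hpi; eexists.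
by move=> k u e1 e2 E; rewrite Hpi E.
Qed.

Lemma accepts_awins : accepts A t <-> awins true ([::], init A).
Proof.
split=> [Ht|]; last exact: awins_accepts.
by case: (awins_determined ([::], init A)) => // /awins_rejects.
Qed.

End Acceptance.

(** * Baire category in the space of trees *)

Section Cylinders.
Variable G : choiceType.
Implicit Types (t : tree G) (D X : set (tree G)).

Definition cyl t K : set (tree G) :=
  fun t' => forall w : seq bool, size w < K -> t' w = t w.

Lemma cylW t K K' : K <= K' -> forall t', cyl t K' t' -> cyl t K t'.
Proof. by move=> KK' t' Ht' w wK; apply: Ht'; apply: leq_trans KK'. Qed.

Lemma cyl_trans t K t1 K1 t2 : K <= K1 -> cyl t K t1 -> cyl t1 K1 t2 -> cyl t K t2.
Proof.
by move=> KK1 H1 H2 w wK; rewrite H2 ?H1 //; apply: leq_trans KK1.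
Qed.

Lemma short_words K : exists s : seq (seq bool), forall w, size w < K -> w \in s.
Proof.
elim: K => [|K [s Hs]]; first by exists [::].
exists ([::] :: map (cons true) s ++ map (cons false) s) => -[|b w] //=.
rewrite ltnS inE mem_cat => /Hs ws; apply/orP; right.
by apply/orP; case: b; [left|right]; apply: map_f.
Qed.

(** Convergence in the product is checked at each word, whose label a deep enough cylinder fixes;
    conversely a cylinder constrains finitely many words. *)
Lemma tree_nbhsP t (U : set (tree G)) :
  nbhs t U <-> exists K, forall t', cyl t K t' -> U t'.
Proof.
split.
  pose Fc : set_system (tree G) := fun U => exists K, forall t', cyl t K t' -> U t'.
  have FF : Filter Fc.
    split; first by exists 0.
      move=> P Q [K HP] [K' HQ]; exists (maxn K K') => t' Ht'; split.
        by apply/HP/(cylW (leq_maxl K K')).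
      by apply/HQ/(cylW (leq_maxr K K')).
    by move=> P Q PQ [K HP]; exists K => t' /HP /PQ.
  suff : cvg_to Fc (nbhs t) by apply.
  apply/cvg_sup => w A. move=> [B [[C oC <-] Ct] BA].
  exists (size w).+1 => t' Ht'; apply: BA => /=; rewrite (Ht' w) //; exact: ltnSn.
case=> K HK.
have [s Hs] := short_words K.
suff H : forall s : seq (seq bool), nbhs t (fun t' : tree G => forall w, w \in s -> t' w = t w).
  by apply: filterS (H s) => t' Ht'; apply: HK => w /Hs; apply: Ht'.
elim=> [|w r IHr]; first exact: filterS filterT.
have Hw : nbhs t (fun t' : tree G => t' w = t w).
  have /= H := @proj_continuous (seq bool) (fun=> discrete_topology G) w t.
  exact: (H [set t w]%classic (discrete_set1 _)).
apply: filterS (filterI Hw IHr) => t' /= [E Er] v.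
by rewrite inE => /orP[/eqP->|/Er].
Qed.

(* [D] contains an open dense set. *)
Definition generic D := forall t K, exists t1 K1,
  cyl t K t1 /\ forall t2, cyl t1 K1 t2 -> D t2.

Lemma nowhere_dense_generic D : nowhere_dense (~` D)%classic <-> generic D.
Proof.
split=> [HD t K|HD].
  have : ~ interior (closure (~` D)%classic) t by rewrite HD.
  move=> /tree_nbhsP Hn.
  have [t1 [Ht1 Dt1]] : exists t1, cyl t K t1 /\ ~ closure (~` D)%classic t1.
    apply: contrapT => H; apply: Hn; exists K => t' Ht'.
    by apply: contrapT => Hc; apply: H; exists t'.
  have [U] : exists U, nbhs t1 U /\ forall t2, U t2 -> D t2.
    apply: contrapT => H; apply: Dt1 => U Ut1.
    apply: contrapT => HU; apply: H; exists U; split=> // t2 Ut2.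
    by apply: contrapT => Dt2; apply: HU; exists t2.
  move=> [/tree_nbhsP[K1 HK1] HU]; exists t1, K1; split=> // t2 Ht2.
  exact/HU/HK1.
rewrite /nowhere_dense -subset0 => t /tree_nbhsP [K HK].
have [t1 [K1 [Ht1 HD1]]] := HD t K.
have := HK _ Ht1; have N1 : nbhs t1 (cyl t1 K1) by apply/tree_nbhsP; exists K1.
by move=> /(_ _ N1) [t2 [Dt2 /HD1]].
Qed.

Lemma genericW D D' : (forall t, D t -> D' t) -> generic D -> generic D'.
Proof.
move=> DD' HD t K; have [t1 [K1 [H1 H2]]] := HD t K.
by exists t1, K1; split=> // t2 /H2 /DD'.
Qed.

Lemma comeagerP X : comeager X <->
  exists D : nat -> set (tree G), (forall n, generic (D n)) /\
    forall t, (forall n, D n t) -> X t.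
Proof.
split=> [[F [HF FX]]|[D [HD DX]]].
  exists (fun n => (~` F n)%classic); split=> [n|t Ht].
    by apply/nowhere_dense_generic; rewrite setCK.
  apply: contrapT => Xt; have : (~` X)%classic t by [].
  by rewrite FX => - [n _ /Ht].
(* [meager] asks for equality with the union, so each piece is cut down to its part outside [X]. *)
exists (fun n => ~` (D n `|` X))%classic; split=> [n|].
  by apply/nowhere_dense_generic; apply: genericW (HD n) => t; left.
apply/seteqP; split=> [t Xt|t [n _ H] Xt]; last by apply: H; right.
apply: contrapT => H; apply: (Xt); apply: DX => n; apply: contrapT => Dn.
by apply: H; exists n => // -[].
Qed.

(** Nested cylinders of strictly increasing depth, the [n]-th step entering [D n]. The limit tree
    reads [w] at stage [(size w).+1], where its label is already fixed. *)
Lemma baire (D : nat -> set (tree G)) t K : (forall n, generic (D n)) ->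
  exists t', cyl t K t' /\ forall n, D n t'.
Proof.
move=> HD; pose B := (tree G * nat)%type.
have /choice [f Hf] (x : nat * B) : exists y : B,
    [/\ cyl x.2.1 x.2.2 y.1, x.2.2 < y.2 & forall t2, cyl y.1 y.2 t2 -> D x.1 t2].
  have [t1 [K1 [H1 H2]]] := HD x.1 x.2.1 x.2.2.
  exists (t1, maxn K1 x.2.2.+1); split=> //=; first exact: leq_maxr.
  by move=> t2 /(cylW (leq_maxl _ _)) /H2.
pose b := fix b n : B := if n is m.+1 then f (m, b m) else (t, K).
have bS n := Hf (n, b n).
have b_lt n : (b n).2 < (b n.+1).2 by case: (bS n).
have b_ge n : n <= (b n).2 by elim: n => // n IHn; apply: leq_ltn_trans (b_lt n).
have b_cyl n k : cyl (b n).1 (b n).2 (b (n + k)).1 /\ (b n).2 <= (b (n + k)).2.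
  elim: k => [|k [H1 H2]]; first by rewrite addn0; split.
  rewrite addnS; case: (bS (n + k)) => H3 H4 _.
  by split; [exact: cyl_trans H2 H1 H3|rewrite (leq_trans H2) // ltnW].
pose t' : tree G := fun w => (b (size w).+1).1 w.
have Ht' n : cyl (b n).1 (b n).2 t'.
  move=> w wn; rewrite /t'; case: (leqP n (size w).+1) => [nw|nw].
    by have [H _] := b_cyl n ((size w).+1 - n); rewrite subnKC // in H; exact: H.
  have [H _] := b_cyl (size w).+1 (n - (size w).+1); rewrite subnKC ?(ltnW nw) // in H.
  by rewrite (H w) // (leq_trans _ (b_ge _)).
exists t'; split; first exact: (Ht' 0).
by move=> n; case: (bS n) => _ _; apply; apply: (Ht' n.+1).
Qed.

Section CountableFamily.
Variables (I : countType) (D : I -> set (tree G)).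
Hypothesis HD : forall i, generic (D i).

Definition count_family (n : nat) : set (tree G) :=
  if unpickle n is Some i then D i else setT.

Lemma count_family_generic n : generic (count_family n).
Proof.
rewrite /count_family; case: (unpickle n) => [i|]; first exact: HD.
by move=> t K; exists t, 0.
Qed.

Lemma count_familyP t : (forall n, count_family n t) -> forall i, D i t.
Proof. by move=> H i; have := H (pickle i); rewrite /count_family pickleK. Qed.

Lemma comeager_family X : (forall t, (forall i, D i t) -> X t) -> comeager X.
Proof.
move=> DX; apply/comeagerP; exists count_family.
by split=> [|t /count_familyP/DX //]; exact: count_family_generic.
Qed.

Lemma not_comeager_family X t K :
  (forall t', cyl t K t' -> (forall i, D i t') -> ~ X t') -> ~ comeager X.
Proof.
move=> HX /comeagerP [D' [HD' DX]].
(* Both families are interleaved so that [baire] gives one tree in all of their members. *)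
pose E n := if odd n then count_family n./2 else D' n./2.
have HE n : generic (E n).
  by rewrite /E; case: ifP => _; [exact: count_family_generic|exact: HD'].
have [t' [Ht' Et']] := baire t K HE.
apply: (HX t' Ht'); [apply: count_familyP|apply: DX] => n.
  by have := Et' n.*2.+1; rewrite /E /= odd_double uphalf_double.
by have := Et' n.*2; rewrite /E odd_double half_double.
Qed.

End CountableFamily.

End Cylinders.

(** * The category game *)

Section InfSetImage.
Variable C : finType.

(** Pigeonhole: if each colour in [p] stopped occurring, the largest of finitely many bounds would
    end all visits to [p]. *)
Lemma inf_set_pick (rho : nat -> C) (p : pred C) :
  (forall n, exists2 m, n <= m & p (rho m)) -> exists2 c, c \in inf_set rho & p c.
Proof.
move=> H; apply: contrapT => Hn.
have /choice [b Hb] : forall c, exists n, forall m, n <= m -> p c -> rho m <> c.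
  move=> c; apply: contrapT => Hc; apply: Hn; exists c; last first.
    by apply: contrapT => pc; apply: Hc; exists 0 => m _ /pc.
  apply/inf_setP => n; apply: contrapT => Hm; apply: Hc; exists n => m nm _ E.
  by apply: Hm; exists m.
have [m bm pm] := H (\max_c b c).
by apply: (Hb (rho m) m _ pm) => //; apply: leq_trans bm; apply: leq_bigmax.
Qed.

Lemma inf_set_image (C' : finType) (f : C -> C') (rho : nat -> C) :
  inf_set (fun i => f (rho i)) = (f @: inf_set rho)%SET.
Proof.
apply/setP => c; apply/inf_setP/imsetP => [H|[x /inf_setP Hx ->] n].
  have [|x Hx /eqP fx] := @inf_set_pick rho (fun x => f x == c); last by exists x.
  by move=> n; have [m nm Hm] := H n; exists m; rewrite ?Hm.
by have [m nm <-] := Hx n; exists m.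
Qed.

End InfSetImage.

Section DlMap.
Variables (X Y : Type) (f : X -> Y).

Fixpoint dl_map (e : dl X) : dl Y :=
  match e with
  | Atom x => Atom (f x)
  | And e1 e2 => And (dl_map e1) (dl_map e2)
  | Or e1 e2 => Or (dl_map e1) (dl_map e2)
  end.

Lemma fdl_map P e (Z : Y -> Prop) : fdl P (dl_map e) Z = fdl P e (fun x => Z (f x)).
Proof. by elim: e => //= e1 -> e2 ->. Qed.

Lemma dl_size_map e : dl_size (dl_map e) = dl_size e.
Proof. by elim: e => //= e1 -> e2 ->. Qed.

End DlMap.

Definition by_player (X : Type) (P : bool) (e1 e2 : dl X) :=
  if P then Or e1 e2 else And e1 e2.

Lemma fdl_by_player (X : Type) P P' (e1 e2 : dl X) Z :
  fdl P (by_player P' e1 e2) Z <->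
  if P' == P then fdl P e1 Z \/ fdl P e2 Z else fdl P e1 Z /\ fdl P e2 Z.
Proof. by case: P; case: P'. Qed.

(** * Automaton of the category game *)

Section Control.
Variables (S G : finType) (A : aut (S * G)%type).
Let Q := state A.

Definition set_ctl (c : bool) (x : bool * Q) : bool * (bool * Q) := (x.1, (c, x.2)).

(** The player in control [c] settles who is in control next before the direction is chosen in
    [e]. *)
Definition pass (c : bool) (e : dl (bool * Q)) :=
  by_player c (dl_map (set_ctl true) e) (dl_map (set_ctl false) e).

(** Since [dl] has no constants, the fold starts from the first expression, which therefore occurs
    twice. *)
Definition pick_letter (c : bool) (d0 : dl (bool * Q)) (s : seq (dl (bool * Q))) :=
  foldl (fun acc e => by_player c (pass c e) acc) (pass c (head d0 s)) s.

Definition ctl_trans (x : bool * Q) (a : S) :=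
  pick_letter x.1 (Atom (false, x.2)) [seq trans x.2 (a, b) | b <- enum G].

(** First case: the universal player keeps the control from some point on, and loses. Second: he has
    it infinitely often and [A] accepts the projection. Nonempty sets with only [true] satisfy
    neither. *)
Definition ctl_acc : {set {set bool * Q}} :=
  [set X : {set bool * Q} | [forall x in X, ~~ x.1] ||
    ([exists x in X, ~~ x.1] && ((snd @: X)%SET \in acc A))]%SET.

Definition ctl_aut : aut S := Aut (false, init A) ctl_trans ctl_acc.

Lemma fdl_pass P c e Z : fdl P (pass c e) Z <->
  if c == P then exists c', fdl P e (fun x => Z (set_ctl c' x))
  else forall c', fdl P e (fun x => Z (set_ctl c' x)).
Proof.
rewrite fdl_by_player !fdl_map; case: ifP => _; split.
- by case=> H; eexists; exact: H.
- by case=> [[]] H; [left|right].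
- by case=> H1 H2 [].
- by [].
Qed.

Lemma fdl_pick_letter P c d0 s Z : 0 < size s ->
  fdl P (pick_letter c d0 s) Z <->
  if c == P then exists2 i, i < size s & fdl P (pass c (nth d0 s i)) Z
  else forall i, i < size s -> fdl P (pass c (nth d0 s i)) Z.
Proof.
move=> s0; rewrite /pick_letter.
have H e0 : fdl P (foldl (fun acc e => by_player c (pass c e) acc) e0 s) Z <->
    if c == P then fdl P e0 Z \/ exists2 i, i < size s & fdl P (pass c (nth d0 s i)) Z
    else fdl P e0 Z /\ forall i, i < size s -> fdl P (pass c (nth d0 s i)) Z.
  elim: s {s0} e0 => [|e s IHs] e0 /=.
    by case: ifP => _; split=> [H|[]//]; [left|case=> i|split].
  have := IHs (by_player c (pass c e) e0); have := fdl_by_player P c (pass c e) e0 Z.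
  case: ifP => _ F I; split.
  - move/I => [/F [H|H]|[i si H]]; [by right; exists 0|by left|by right; exists i.+1].
  - case=> [H|[[|i] si H]]; apply/I; last by right; exists i.
      by left; apply/F; right.
    by left; apply/F; left.
  - by move/I => [/F [H1 H2] H3]; split=> // -[|i] // /H3.
  - case=> H1 H2; apply/I; split; last by move=> i; exact: (H2 i.+1).
    by apply/F; split=> //; exact: (H2 0).
have := H (pass c (head d0 s)); rewrite -nth0; case: ifP => _ {}H; (split; [move/H|move=> H'; apply/H; move: H']).
- by case=> // H0; exists 0.
- by right.
- by case.
- by move=> H1; split=> //; apply: H1.
Qed.

Lemma fdl_ctl_trans P c q a Z : 0 < #|G| ->
  fdl P (ctl_trans (c, q) a) Z <->
  if c == P then exists b c', fdl P (trans q (a, b)) (fun x => Z (set_ctl c' x))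
  else forall b c', fdl P (trans q (a, b)) (fun x => Z (set_ctl c' x)).
Proof.
move=> G0; have [b0 _] := card_gt0P G0.
have sE : size [seq trans q (a, b) | b <- enum G] = #|G| by rewrite size_map cardE.
have nthE b : nth (Atom (false, q)) [seq trans q (a, b) | b <- enum G] (index b (enum G))
    = trans q (a, b).
  by rewrite (nth_map b0) ?nth_index ?index_mem ?mem_enum.
have idx b : index b (enum G) < #|G| by rewrite cardE index_mem mem_enum.
have nthE' i : i < #|G| -> exists b,
    nth (Atom (false, q)) [seq trans q (a, b) | b <- enum G] i = trans q (a, b).
  by move=> iG; exists (nth b0 (enum G) i); rewrite (nth_map b0) -?cardE.
rewrite /ctl_trans fdl_pick_letter /= sE //; case: ifP => cP; split.
- case=> i /nthE' [b ->]; rewrite fdl_pass cP => -[c' H]; by exists b, c'.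
- by case=> b [c' H]; exists (index b (enum G)); rewrite ?nthE ?fdl_pass ?cP //; exists c'.
- by move=> H b c'; have := H _ (idx b); rewrite nthE fdl_pass cP; apply.
- by move=> H i /nthE' [b ->]; rewrite fdl_pass cP => c'.
Qed.

Lemma ctl_acc_own P (rho : nat -> bool * Q) :
  (forall i, (rho i).1 = P) -> ~ won ctl_acc P rho.
Proof.
move=> Hrho; rewrite /won inE.
have HX x : x \in inf_set rho -> x.1 = P by move=> /inf_setP /(_ 0) [m _ <-].
have [|x Hx _] := @inf_set_pick _ rho predT; first by move=> n; exists n.
case: P Hrho HX => _ HX.
  case: forallP => [/(_ x)|_] /=; first by rewrite Hx (HX x).
  by case: existsP => //= -[y /andP[/HX ->]].
by case: forallP => //= -[] y; apply/implyP => /HX ->.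
Qed.

(** Both values of the control recur, which leaves only the condition of [A] on the projection. *)
Lemma ctl_acc_alternate P (rho : nat -> bool * Q) :
  (forall n, exists2 i, n <= i & (rho i).1 = P /\ (rho i.+1).1 <> P) ->
  won ctl_acc P rho -> won (acc A) P (fun i => (rho i).2).
Proof.
move=> H; rewrite /won inE inf_set_image.
have Hc c : exists2 x, x \in inf_set rho & x.1 == c.
  apply: inf_set_pick => n; have [i ni [H1 H2]] := H n.
  have [->|/eqP cP] := eqVneq c P; first by exists i => //; apply/eqP.
  by exists i.+1; [exact: leqW|]; case: (c) (P) (rho i.+1).1 cP H2 => [] [] [].
have [x Hx /eqP x1] := Hc true; have [y Hy /eqP y1] := Hc false.
case: forallP => [/(_ x)|_] /=; first by rewrite Hx x1.
by case: existsP => //= -[]; exists y; rewrite Hy y1.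
Qed.

End Control.

(** * Strategies of the category game played along a generic tree *)

Section Generic.
Variables (S G : finType) (A : aut (S * G)%type).
Hypotheses (gameA : game_aut A) (G0 : 0 < #|G|).
Variables (t : tree S) (P : bool).
Notation B := (ctl_aut A).
Variables (g : sgraph snd (acc B) (aforce (A := B) t) (fun=> True) (fun=> False) P).
Implicit Types (n : node g) (b : G) (c d : bool) (r : tree G).

Fixpoint target (X : Type) (e : dl (bool * X)) (d : bool) : X :=
  match e with
  | Atom x => x.2
  | And e1 e2 | Or e1 e2 => target (if d then e2 else e1) d
  end.

(** In a game automaton the direction determines the state, so a round is described by letter,
    control and direction alone. *)
Lemma game_fdl q a (Z : bool * state A -> Prop) : fdl P (trans q a) Z ->
  fdl P (trans q a) (fun x => Z x /\ x.2 = target (trans q a) x.1).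
Proof.
have [qL [qR [->|->]]] := gameA q a => /=.
  by case: P; tauto.
by case: P; tauto.
Qed.

Definition nword n := (lab n).1.
Definition nctl n := (lab n).2.1.
Definition nst n := (lab n).2.2.

Definition succ_lab n b c d :=
  (rcons (nword n) d, (c, target (trans (nst n) (t (nword n), b)) d)).

Definition legal n b c d := exists2 n', edge n n' & lab n' = succ_lab n b c d.

Definition nxt n (s : G * bool * bool) : node g :=
  match pselect (legal n s.1.1 s.1.2 s.2) with
  | left H => s2val (cid2 H)
  | right _ => n
  end.

Lemma nxtP n b c d : legal n b c d ->
  edge n (nxt n (b, c, d)) /\ lab (nxt n (b, c, d)) = succ_lab n b c d.
Proof. by rewrite /nxt => Hl; case: pselect => // H; case: (cid2 H). Qed.

Definition opts n b c :=
  fdl P (trans (nst n) (t (nword n), b)) (fun x => legal n b c x.1).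

Lemma opts_own n : nctl n = P -> exists bc, opts n bc.1 bc.2.
Proof.
rewrite /opts /legal /succ_lab /nctl /nst /nword.
have := lab_force n; rewrite /aforce; case: (lab n) => u [c q] /= H cP.
move: H; rewrite fdl_ctl_trans // cP eqxx => -[b [c' H]].
exists (b, c'); apply: fdl_mono (game_fdl H) => -[d q'] /= [[//|[n' En' ln']] <-].
by exists n'.
Qed.

Lemma opts_opp n b c : nctl n <> P -> opts n b c.
Proof.
rewrite /opts /legal /succ_lab /nctl /nst /nword.
have := lab_force n; rewrite /aforce; case: (lab n) => u [c1 q] /= H /eqP cP.
move: H; rewrite fdl_ctl_trans // (negbTE cP) => /(_ b c) H.
apply: fdl_mono (game_fdl H) => -[d q'] /= [[//|[n' En' ln']] <-].
by exists n'.
Qed.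

Lemma pick_exists n : exists bc, nctl n = P -> opts n bc.1 bc.2.
Proof.
have [b0 _] := card_gt0P G0.
have [cP|cP] := pselect (nctl n = P); last by exists (b0, P).
by have [bc Hbc] := opts_own cP; exists bc.
Qed.

Definition pick n := sval (cid (pick_exists n)).

Lemma pickP n : nctl n = P -> opts n (pick n).1 (pick n).2.
Proof. exact: (svalP (cid (pick_exists n))). Qed.

Definition allowed r n c := nctl n = P -> pick n = (r (nword n), c).

Lemma allowed_opts r n c : allowed r n c -> opts n (r (nword n)) c.
Proof.
have [cP /(_ cP) E|cP _] := pselect (nctl n = P); last exact: opts_opp.
by have := pickP cP; rewrite E.
Qed.

(* Within [m] steps the simulated play completes a phase in which [P] chooses
   the letters, and these choices agree with [r]; letters chosen by the
   opponent are read off [r], and [P] decides when the opponent passes. *)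
Fixpoint reach r (m : nat) n : Prop :=
  if m is m'.+1 then
    exists2 c, allowed r n c & forall d, legal n (r (nword n)) c d ->
      (nctl n = P /\ c <> P) \/ reach r m' (nxt n (r (nword n), c, d))
  else False.

Lemma nword_nxt n b c d : legal n b c d -> nword (nxt n (b, c, d)) = rcons (nword n) d.
Proof. by move=> /nxtP [_ E]; rewrite /nword E. Qed.

Lemma nctl_nxt n b c d : legal n b c d -> nctl (nxt n (b, c, d)) = c.
Proof. by move=> /nxtP [_ E]; rewrite /nctl E. Qed.

(** The simulation reads only labels of extensions of [nword n], on [m] levels; hence [reach] is an
    open condition on [r]. *)
Lemma reach_local t1 t2 m n :
  (forall w, prefix (nword n) w -> size w < size (nword n) + m -> t2 w = t1 w) ->
  reach t1 m n -> reach t2 m n.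
Proof.
elim: m n => //= m IHm n Ht [c Hc Hn].
have E : t2 (nword n) = t1 (nword n).
  by apply: Ht; rewrite ?prefix_refl // addnS ltnS leq_addr.
exists c; first by rewrite /allowed E.
move=> d; rewrite E => Hl; case: (Hn d Hl) => [|Hd]; [by left|right].
apply: IHm Hd => w; rewrite (nword_nxt Hl) size_rcons => pw sw.
by apply: Ht; [apply: prefix_trans pw; exact: prefix_rcons|rewrite addnS -addSn].
Qed.

Lemma reachW r m m' n : m <= m' -> reach r m n -> reach r m' n.
Proof.
elim: m m' n => //= m IHm [|m'] //= n mm' [c Hc Hn].
by exists c => // d /Hn [|/(IHm m')]; [left|right; auto].
Qed.

(** The subtrees in the two directions are disjoint, so the trees found for the two children glue
    into one, with [b] at their parent; the larger bound serves both. *)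
Lemma reach_glue t0 K n b c :
  (nctl n = P -> pick n = (b, c)) -> (size (nword n) < K -> b = t0 (nword n)) ->
  (forall d, legal n b c d -> (nctl n = P /\ c <> P) \/
     exists m t1, cyl t0 K t1 /\ reach t1 m (nxt n (b, c, d))) ->
  exists m t1, cyl t0 K t1 /\ reach t1 m n.
Proof.
move=> Hp Hb Hd; set u := nword n in Hb.
have /choice [f Hf] : forall d, exists mt : nat * tree G, cyl t0 K mt.2 /\
    (legal n b c d -> (nctl n = P /\ c <> P) \/ reach mt.2 mt.1 (nxt n (b, c, d))).
  move=> d; have [Hl|Hl] := pselect (legal n b c d); last by exists (0, t0).
  case: (Hd d Hl) => [H|[m [t1 [H1 H2]]]]; first by exists (0, t0); split=> // _; left.
  by exists (m, t1); split=> // _; right.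
pose t1 : tree G := fun w => if w == u then b else
  if prefix (rcons u true) w then (f true).2 w else
  if prefix (rcons u false) w then (f false).2 w else t0 w.
have t1u : t1 u = b by rewrite /t1 eqxx.
have t1d d w : prefix (rcons u d) w -> t1 w = (f d).2 w.
  move=> pw; rewrite /t1; case: eqP pw => [-> /size_prefix|_].
    by rewrite size_rcons ltnn.
  case/prefixP => v ->; rewrite -!cats1 -catA !prefix_catr // eqxx.
  by case: d; rewrite /= prefix0s.
exists (maxn (f true).1 (f false).1).+1, t1; split.
  move=> w wK; rewrite /t1; case: eqP => [wu|_]; first by rewrite wu in wK *; exact: Hb.
  by case: ifP => _; [|case: ifP => // _]; apply: (Hf _).1.
exists c; first by rewrite /allowed -/u t1u.
move=> d; rewrite -/u t1u => Hl.
case: ((Hf d).2 Hl) => [|Hr]; [by left|right].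
apply: (@reachW _ (f d).1); first by case: (d); rewrite ?leq_maxl ?leq_maxr.
apply: reach_local Hr => w; rewrite (nword_nxt Hl) => pw _; exact: t1d.
Qed.

(** Koenig's argument: if no tree works at [n], by gluing some child is bad too, with [P] still in
    control. Iterating gives a path on which [P] never passes, against [ctl_acc_own]. *)
Lemma reach_own t0 K n : nctl n = P -> K <= size (nword n) ->
  exists m t1, cyl t0 K t1 /\ reach t1 m n.
Proof.
move=> cP nK; apply: contrapT => Hn.
pose bad n := [/\ nctl n = P, K <= size (nword n) &
  ~ exists m t1, cyl t0 K t1 /\ reach t1 m n].
have step (x : {n | bad n}) : exists y : {n | bad n}, edge (sval x) (sval y).
  case: x => n' [cP' nK' bad'] /=; apply: contrapT => Hy; apply: bad'.
  case E : (pick n') => [b c].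
  apply: (@reach_glue _ _ _ b c) => [//||d Hl]; first by rewrite ltnNge nK'.
  have [cc|/eqP cc] := eqVneq c P; last by left.
  rewrite cc in Hl *; right; apply: contrapT => Hb; apply: Hy.
  have [En ln] := nxtP Hl.
  suff Hbad : bad (nxt n' (b, P, d)) by exists (exist _ _ Hbad).
  split; [exact: nctl_nxt|by rewrite (nword_nxt Hl) size_rcons leqW|exact: Hb].
have /choice [f Hf] := step.
have Hbad : bad n by [].
pose x i := iter i f (exist _ n Hbad).
have := path_won (s := g) (rho := fun i => sval (x i)) (fun i => Hf (x i)).
by apply: ctl_acc_own => i; case: (svalP (x i)).
Qed.

(** The opponent copies his letters from [t0] and keeps the control down to level [K]; there he
    passes, and [reach_own] treats the phase of [P] below the constrained levels. *)
Lemma reach_generic n : nctl n <> P -> generic (fun r => exists m, reach r m n).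
Proof.
move=> cP t0 K.
suff [m [t1 [H1 H2]]] : exists m t1, cyl t0 K t1 /\ reach t1 m n.
  exists t1, (size (nword n) + m); split=> // t2 Ht2; exists m.
  by apply: reach_local H2 => w _; exact: Ht2.
move: {2}(K - _) (leqnn (K - size (nword n))) => k.
elim: k n cP => [|k IHk] n cP.
  rewrite leqn0 subn_eq0 => Kn; have [b0 _] := card_gt0P G0.
  apply: (@reach_glue _ _ _ b0 P) => //; first by rewrite ltnNge Kn.
  move=> d Hl; right; apply: reach_own; first exact: nctl_nxt.
  by rewrite (nword_nxt Hl) size_rcons leqW.
move=> Kn; apply: (@reach_glue _ _ _ (t0 (nword n)) (~~ P)) => // d Hl.
right; apply: IHk; first by rewrite (nctl_nxt Hl); case: (P).
by rewrite (nword_nxt Hl) size_rcons subnS -subn1 leq_subLR add1n.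
Qed.

Lemma reach_wins r n0 m0 : lab n0 = ([::], init B) -> reach r m0 n0 ->
  (forall h, nctl (foldl nxt n0 h) <> P -> exists m, reach r m (foldl nxt n0 h)) ->
  awins (pair_tree t r) P ([::], init A).
Proof.
move=> ln0 Hm0 HD; pose nd h := foldl nxt n0 h.
(* A node is a history with a bound on the steps left until [P] next passes; the bound decreases,
   and is renewed when he passes. *)
pose N := {x : seq (G * bool * bool) * nat | reach r x.2 (nd x.1)}.
pose l (a : N) := (nword (nd (sval a).1), nst (nd (sval a).1)).
pose E (a a' : N) := let n := nd (sval a).1 in exists c d,
  [/\ legal n (r (nword n)) c d,
      (sval a').1 = rcons (sval a).1 (r (nword n), c, d)
    & (sval a').2 < (sval a).2 \/ (nctl n = P /\ c <> P)].
have Elab a a' : E a a' -> exists c d, let n := nd (sval a).1 in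
    edge n (nd (sval a').1) /\ lab (nd (sval a').1) = succ_lab n (r (nword n)) c d.
  move=> [c [d [Hl -> _]]]; exists c, d; rewrite /nd foldl_rcons; exact: nxtP.
have lf a : aforce (A := A) (pair_tree t r) P (l a)
    (fun v => False \/ exists2 b, E a b & l b = v).
  case: a => -[h [|m]] // Hr; case: (Hr) => c Hc Hd.
  have Ho : opts (nd h) (r (nword (nd h))) c := allowed_opts Hc.
  apply: fdl_mono (game_fdl Ho) => -[d q] /= [Hl ->]; right.
  have Hnd : nd (rcons h (r (nword (nd h)), c, d)) = nxt (nd h) (r (nword (nd h)), c, d).
    by rewrite /nd foldl_rcons.
  have [m' [Hm' Hlt]] : exists m', reach r m' (nd (rcons h (r (nword (nd h)), c, d))) /\
      (m' < m.+1 \/ (nctl (nd h) = P /\ c <> P)).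
    rewrite Hnd; case: (Hd d Hl) => [[cP cc]|Hm]; last by exists m; split=> //; left.
    have [m' Hm'] : exists m', reach r m' (nd (rcons h (r (nword (nd h)), c, d))).
      by apply: HD; rewrite -/(nd _) Hnd (nctl_nxt Hl).
    by exists m'; rewrite -Hnd; split=> //; right.
  exists (exist _ (rcons h (r (nword (nd h)), c, d), m') Hm').
    by exists c, d.
  by rewrite /l /= Hnd /nword /nst (nxtP Hl).2.
have lw (rho : nat -> N) : (forall i, E (rho i) (rho i.+1)) ->
    won (acc A) P (fun i => (l (rho i)).2).
  move=> Hrho; pose ch i := (lab (nd (sval (rho i)).1)).2.
  apply: (@ctl_acc_alternate _ _ A P ch).
    (* If [P] no longer passed after [k], the bounds would decrease forever. *)
    move=> k; apply: contrapT => Hk.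
    have dec i : k <= i -> (sval (rho i.+1)).2 < (sval (rho i)).2.
      move=> ki; case: (Hrho i) => c [d [Hl Hh [//|[cP cc]]]].
      case: Hk; exists i => //; split=> //; rewrite /ch Hh /nd foldl_rcons.
      by rewrite -[(lab _).2.1]/(nctl _) (nctl_nxt Hl).
    have H i : (sval (rho (k + i))).2 + i <= (sval (rho k)).2.
      elim: i => [|i IHi]; first by rewrite !addn0.
      by rewrite addnS -addSn addnS (leq_trans _ IHi) // leq_add2r dec ?leq_addr.
    by have := H (sval (rho k)).2.+1; rewrite addnS ltnNge leq_addl.
  apply: (path_won (s := g) (rho := fun i => nd (sval (rho i)).1)) => i.
  by case: (Elab _ _ (Hrho i)) => c [d []].
have Hm0' : reach r m0 (nd [::]) by [].
exists (SGraph (fun=> I) lf lw), (exist _ ([::], m0) Hm0').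
by rewrite /= /l /= /nword /nst /nd /= ln0.
Qed.

End Generic.

Theorem lang_ctl_aut (S G : finType) (A : aut (S * G)%type) :
  game_aut A -> 0 < #|G| -> lang (ctl_aut A) = forall_star (lang A).
Proof.
move=> gameA G0; have [b0 _] := card_gt0P G0.
(* Histories form a countable type, so the generic sets attached to nodes form a countable
   family. *)
pose hist := seq (G * bool * bool).
apply/seteqP; split=> t.
  move/accepts_awins => [g [n0 Hn0]].
  pose D (h : hist) (r : tree G) :=
    nctl (foldl (@nxt _ _ _ _ _ g) n0 h) <> true ->
    exists m, reach gameA G0 r m (foldl (@nxt _ _ _ _ _ g) n0 h).
  apply: (@comeager_family _ _ D) => [h|r Hr].
    have [cP|cP] := pselect (nctl (foldl (@nxt _ _ _ _ _ g) n0 h) = true).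
      by move=> t0 K; exists t0, 0; split=> // t2 _ /(_ cP).
    by apply: genericW (reach_generic gameA G0 cP) => r Hr _.
  have [|m Hm] := Hr [::]; first by rewrite /= /nctl Hn0.
  by apply/accepts_awins; apply: (reach_wins Hn0 Hm Hr).
move=> Ht; apply/accepts_awins.
case: (awins_determined t ([::], init (ctl_aut A))) => // -[g [n0 Hn0]].
pose D (h : hist) (r : tree G) :=
  nctl (foldl (@nxt _ _ _ _ _ g) n0 h) <> false ->
  exists m, reach gameA G0 r m (foldl (@nxt _ _ _ _ _ g) n0 h).
(* The universal player has the control at the root; his first phase gives a cylinder on which the
   simulation can start. With [K = 0] the base tree is arbitrary. *)
have [|//|m [t1 [_ Hm]]] := @reach_own _ _ _ gameA G0 t false g (fun=> b0) 0 n0.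
  by rewrite /nctl Hn0.
have HD h : generic (D h).
  have [cP|cP] := pselect (nctl (foldl (@nxt _ _ _ _ _ g) n0 h) = false).
    by move=> t0 K; exists t0, 0; split=> // t2 _ /(_ cP).
  by apply: genericW (reach_generic gameA G0 cP) => r Hr _.
case: (@not_comeager_family _ _ D HD [set t' | lang A (pair_tree t t')]%classic t1 m) => //.
move=> r Hrt Hr.
have Hm' : reach gameA G0 r m n0.
  by apply: reach_local Hm => w _; rewrite /nword Hn0 add0n; apply: Hrt.
exact/awins_rejects/(reach_wins Hn0 Hm' Hr).
Qed.

(** * Acceptance formula and size *)

Section ControlFormula.
Variable Q : finType.

Fixpoint either_ctl (phi : bform Q) : bform (bool * Q) :=
  match phi with
  | BVar q => BOr (BVar (true, q)) (BVar (false, q))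
  | BNot f => BNot (either_ctl f)
  | BAnd f g => BAnd (either_ctl f) (either_ctl g)
  | BOr f g => BOr (either_ctl f) (either_ctl g)
  end.

Definition some_ctl (q0 : Q) (c : bool) : bform (bool * Q) :=
  foldl (fun f q => BOr (BVar (c, q)) f) (BVar (c, q0)) (enum Q).

Lemma beval_either_ctl (X : {set bool * Q}) phi :
  beval X (either_ctl phi) = beval (snd @: X)%SET phi.
Proof.
elim: phi => //= [q|f ->|f -> g ->|f -> g ->] //.
apply/orP/imsetP => [[|] H|[[[] q'] H ->]]; by [exists (true, q)|exists (false, q)|left|right].
Qed.

Lemma beval_some_ctl (X : {set bool * Q}) q0 c :
  beval X (some_ctl q0 c) = [exists x in X, x.1 == c].
Proof.
have H s f : beval X (foldl (fun f q => BOr (BVar (c, q)) f) f s) =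
    has (fun q => (c, q) \in X) s || beval X f.
  by elim: s f => //= q s IHs f; rewrite IHs /= orbCA orbA.
rewrite /some_ctl H /=; apply/orP/existsP => [[/hasP [q _ Hq]|Hq]|[[c' q] /andP[Hq /eqP /= <-]]].
- by exists (c, q); rewrite Hq /=.
- by exists (c, q0); rewrite Hq /=.
- by left; apply/hasP; exists q; rewrite ?mem_enum.
Qed.

Lemma bform_size_either_ctl phi : bform_size (either_ctl phi) <= 3 * bform_size phi.
Proof.
by elim: phi => //= [f IHf|f IHf g IHg|f IHf g IHg]; lia.
Qed.

Lemma bform_size_some_ctl q0 c : bform_size (some_ctl q0 c) = #|Q|.*2.+1.
Proof.
have H s f : bform_size (foldl (fun f q => BOr (BVar (c, q)) f) f s) =
    (size s).*2 + bform_size f.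
  by elim: s f => //= q s IHs f; rewrite IHs /= add1n doubleS !addSnnS.
by rewrite /some_ctl H /= -cardE addn1.
Qed.

Lemma bform_size_gt0 (X : Type) (phi : bform X) : 0 < bform_size phi.
Proof. by case: phi. Qed.

End ControlFormula.

Section ControlSize.
Variables (S G : finType) (A : aut (S * G)%type).
Let Q := state A.

Definition ctl_form (phi : bform Q) : bform (state (ctl_aut A)) :=
  BOr (BNot (some_ctl (init A) true)) (BAnd (some_ctl (init A) false) (either_ctl phi)).

Lemma describes_ctl_form phi : describes phi (acc A) ->
  describes (ctl_form phi) (acc (ctl_aut A)).
Proof.
move=> Hphi X; rewrite inE /= !beval_some_ctl beval_either_ctl -Hphi.
rewrite negb_exists; congr (_ || (_ && _)).
  by apply: eq_forallb => x; rewrite negb_and; case: (x \in X) => //=; rewrite eqb_id.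
by apply: eq_existsb => x; rewrite eqbF_neg.
Qed.

Lemma bform_size_ctl_form phi :
  bform_size (ctl_form phi) <= 4 * #|Q| + 8 * bform_size phi.
Proof.
rewrite /= !bform_size_some_ctl.
have := bform_size_either_ctl phi; have := bform_size_gt0 phi.
by set n := #|Q|; set k := bform_size phi; set l := bform_size _; lia.
Qed.

(** A game transition has size 3. A letter of [G] costs 7 for [pass] and 1 for the connective, and
    the initial term 7. As the states double, [2 * (7 + 8 * #|G|) <= 10 * 3 * #|G|] is what is
    used. *)
Lemma graph_size_ctl_aut : game_aut A -> 0 < #|G| ->
  graph_size (ctl_aut A) <= 10 * graph_size A.
Proof.
move=> gameA G0.
have dl3 (q : Q) a : dl_size (trans q a) = 3.
  by have [qL [qR [->|->]]] := gameA q a.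
have pass_size c (q : Q) a : dl_size (pass c (trans q a)) = 7.
  by rewrite /pass; case: c => /=; rewrite !dl_size_map dl3.
have Hs c (q : Q) a : dl_size (ctl_trans (c, q) a) = 7 + 8 * #|G|.
  rewrite /ctl_trans /pick_letter /=.
  have H (s : seq G) e : dl_size (foldl (fun acc e => by_player c (pass c e) acc) e
      [seq trans q (a, b) | b <- s]) = dl_size e + 8 * size s.
    elim: s e => [|b s IHs] e /=; first by rewrite muln0 addn0.
    by rewrite IHs /by_player; case: c {IHs} (pass_size c q (a, b)) => /= ->; rewrite mulnS; lia.
  rewrite H -cardE; congr (_ + _).
  by move: G0; rewrite cardE; case: (enum G) => //= b s _.
rewrite /graph_size /= card_prod card_bool.
have -> : \sum_(x : bool * Q) \sum_a dl_size (ctl_trans x a) =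
    2 * #|Q| * (#|S| * (7 + 8 * #|G|)).
  rewrite (eq_bigr (fun=> #|S| * (7 + 8 * #|G|))) => [|[c q] _].
    by rewrite sum_nat_const card_prod card_bool.
  by rewrite (eq_bigr (fun=> 7 + 8 * #|G|)) ?sum_nat_const // => a _; rewrite Hs.
have -> : \sum_(q : Q) \sum_a dl_size (trans q a) = #|Q| * (#|S| * #|G| * 3).
  rewrite (eq_bigr (fun=> #|S| * #|G| * 3)) ?sum_nat_const // => q _.
  by rewrite (eq_bigr (fun=> 3)) ?sum_nat_const ?card_prod // => a _; rewrite dl3.
move: G0; set n := #|Q|; set s := #|S|; set k := #|G| => k0.
have H : n * s <= n * s * k by rewrite leq_pmulr.
nia.
Qed.

End ControlSize.

(** * Computable functions on binary trees *)

Definition computable (f : data -> data) := exists p, forall x, run p x (f x).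

Lemma computable_id : computable (fun x => x).
Proof. by exists PId => x; constructor. Qed.

Lemma computable_comp f g :
  computable g -> computable f -> computable (fun x => g (f x)).
Proof.
by move=> [q Hq] [p Hp]; exists (PSeq p q) => x; apply: RunSeq (Hp x) (Hq _).
Qed.

Lemma computable_cons f g :
  computable f -> computable g -> computable (fun x => Cons (f x) (g x)).
Proof. by move=> [p Hp] [q Hq]; exists (PCons p q) => x; constructor. Qed.

Lemma computable_fst f : computable f -> computable (fun x => fst_data (f x)).
Proof. by apply: computable_comp; exists PFst => x; constructor. Qed.

Lemma computable_snd f : computable f -> computable (fun x => snd_data (f x)).
Proof. by apply: computable_comp; exists PSnd => x; constructor. Qed.

Lemma computable_const d : computable (fun=> d).
Proof.
elim: d => [|x Hx y Hy]; last exact: computable_cons Hx Hy.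
by exists PNil => x; constructor.
Qed.

Lemma computable_if c f g : computable c -> computable f -> computable g ->
  computable (fun x => if c x is Cons _ _ then f x else g x).
Proof.
move=> [r Hr] [p Hp] [q Hq]; exists (PIf r p q) => x.
have := Hr x; case: (c x) => [|a b] Hc; first exact: RunIfNil Hc (Hq x).
exact: RunIfCons Hc (Hp x).
Qed.

Ltac comp_with2 l l' := repeat (first
  [ assumption
  | exact: computable_id
  | exact: computable_const
  | apply l
  | apply l'
  | apply: computable_if
  | apply: computable_cons
  | apply: computable_fst
  | apply: computable_snd ]).
Ltac comp_with l := comp_with2 l l.
Ltac comp := comp_with computable_id.

Section Recursion.
Variables g h : data -> data.
Hypotheses (comp_g : computable g) (comp_h : computable h).

Fixpoint drec e d : data :=
  match d with
  | Nil => g e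
  | Cons x y => h (Cons e (Cons d (Cons (drec e x) (drec e y))))
  end.

(* The store is [Cons e (Cons todo out)]: [todo] is a stack of subtrees to be
   visited (tag [Nil]) and of nodes whose children have been dealt with and
   whose value is to be computed (tag [Cons Nil Nil]); [out] is a stack of values. *)
Let store e todo out := Cons e (Cons todo out).
Let visit d := Cons Nil d.
Let combine d := Cons (Cons Nil Nil) d.

Let env s := fst_data s.
Let kind s := fst_data (fst_data (fst_data (snd_data s))).
Let arg s := snd_data (fst_data (fst_data (snd_data s))).
Let rest s := snd_data (fst_data (snd_data s)).
Let out s := snd_data (snd_data s).

Let step s :=
  if kind s is Cons _ _ then
    store (env s) (rest s)
      (Cons (h (Cons (env s) (Cons (arg s)
                 (Cons (fst_data (snd_data (out s))) (fst_data (out s))))))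
            (snd_data (snd_data (out s))))
  else if arg s is Cons _ _ then
    store (env s) (Cons (visit (fst_data (arg s)))
      (Cons (visit (snd_data (arg s))) (Cons (combine (arg s)) (rest s)))) (out s)
  else store (env s) (rest s) (Cons (g (env s)) (out s)).

Lemma computable_drec a b :
  computable a -> computable b -> computable (fun x => drec (a x) (b x)).
Proof.
move=> Ha Hb.
have [body Hbody] : computable step.
  rewrite /step /store /visit /combine /env /kind /arg /rest /out.
  by comp; [apply: computable_comp comp_h _|apply: computable_comp comp_g _]; comp.
have [init Hinit] : computable (fun x => store (a x) (Cons (visit (b x)) Nil) Nil).
  by rewrite /store /visit; comp.
have [todo Htodo] : computable (fun x => fst_data (snd_data x)) by comp.
have [res Hres] : computable (fun x => fst_data (snd_data (snd_data x))) by comp.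
have loop e i td o z s' : step (store e (Cons i td) o) = s' ->
    run (PWhile todo body) s' z -> run (PWhile todo body) (store e (Cons i td) o) z.
  move=> <-; exact: (@RunWhileCons todo body (store e (Cons i td) o) i td _ z
    (Htodo _) (Hbody _)).
have visitP e d td o z :
    run (PWhile todo body) (store e td (Cons (drec e d) o)) z ->
    run (PWhile todo body) (store e (Cons (visit d) td) o) z.
  elim: d td o => [|x IHx y IHy] td o Hz.
    exact: (loop e (visit Nil) td o z _ erefl Hz).
  (* The value of the right child ends on top of the output stack, hence the order in which [step]
     takes the two values. *)
  apply: (loop e (visit (Cons x y)) td o z _ erefl); apply: IHx; apply: IHy.
  exact: (loop e (combine (Cons x y)) td
    (Cons (drec e y) (Cons (drec e x) o)) z _ erefl Hz).
exists (PSeq init (PSeq (PWhile todo body) res)) => x.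
pose s := store (a x) Nil (Cons (drec (a x) (b x)) Nil).
apply: RunSeq (Hinit x) _; apply: (@RunSeq _ _ _ s); last exact: (Hres s).
by apply: visitP; apply: RunWhileNil; exact: (Htodo s).
Qed.

End Recursion.

Section ListRecursion.
Variables g h : data -> data.
Hypotheses (comp_g : computable g) (comp_h : computable h).

Fixpoint lrec e l : data :=
  match l with
  | Nil => g e
  | Cons x l' => h (Cons e (Cons l (lrec e l')))
  end.

(** Recursion along the right spine is [drec] with the value at the left subtree discarded. *)
Lemma computable_lrec a b :
  computable a -> computable b -> computable (fun x => lrec (a x) (b x)).
Proof.
pose h' p := h (Cons (fst_data p) (Cons (fst_data (snd_data p))
                  (snd_data (snd_data (snd_data p))))).
have Hh' : computable h' by apply: computable_comp comp_h _; comp.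
have -> : lrec = drec g h'.
  apply/funext => e; apply/funext => l.
  by elim: l => //= x _ l' ->.
exact: computable_drec.
Qed.

End ListRecursion.

(** * Translation of codes of automata *)

Definition p_hd p := fst_data (fst_data (snd_data p)).
Definition p_tl p := snd_data (fst_data (snd_data p)).
Definition p_rec p := snd_data (snd_data p).

Definition dcat a b := lrec id (fun p => Cons (p_hd p) (p_rec p)) b a.

Lemma computable_dcat a b : computable a -> computable b ->
  computable (fun x => dcat (a x) (b x)).
Proof.
move=> Ha Hb; apply: computable_lrec => //; rewrite /p_hd /p_rec; comp.
Qed.

Lemma dcat_code_seq s1 s2 : dcat (code_seq s1) (code_seq s2) = code_seq (s1 ++ s2).
Proof. by elim: s1 => //= x s ; rewrite /dcat /= => ->. Qed.

Lemma code_natE n : code_nat n = code_seq (nseq n Nil).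
Proof. by elim: n => //= n ->. Qed.

Lemma dcat_code_nat m n : dcat (code_nat m) (code_nat n) = code_nat (m + n).
Proof. by rewrite !code_natE dcat_code_seq nseqD. Qed.

(** Pairs with control [true] are enumerated first, so the rank of [(false, q)] is that of [q]
    shifted by the number [n] of states. *)
Definition dstate (c : bool) n s := if c then s else dcat n s.

Definition datom c n at_ :=
  Cons Nil (Cons (fst_data (snd_data at_))
    (Cons (dstate c n (fst_data (snd_data (snd_data at_)))) Nil)).

(** Written for the shape of a game transition: a connective, whose tag is kept, and two atoms. *)
Definition dlift c n e :=
  Cons (fst_data e) (Cons (datom c n (fst_data (snd_data e)))
    (Cons (datom c n (fst_data (snd_data (snd_data e)))) Nil)).

Definition dby (c : bool) e1 e2 :=
  Cons (code_nat (if c then 2 else 1)) (Cons e1 (Cons e2 Nil)).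

Definition dpass c n e := dby c (dlift true n e) (dlift false n e).

(* The environment is [Cons n row]; returns what remains of the row, and the
   transition built from its first letters. *)
Definition dletters c n G row := lrec
  (fun e => Cons (snd_data e) (dpass c (fst_data e) (fst_data (snd_data e))))
  (fun p => Cons (snd_data (fst_data (p_rec p)))
     (dby c (dpass c (fst_data (fst_data p)) (fst_data (fst_data (p_rec p))))
            (snd_data (p_rec p))))
  (Cons n row) G.

Definition drow_step c n G r :=
  Cons (fst_data (dletters c n G (fst_data r)))
       (dcat (snd_data r) (Cons (snd_data (dletters c n G (fst_data r))) Nil)).

(** The recursion pairs the unread part of the row with the transitions built so far; the unary
    sizes of the alphabets are the loop counters. *)
Definition drow c n G S row := snd_data (lrec
  (fun e => Cons (snd_data (snd_data e)) Nil)
  (fun p => drow_step c (fst_data (fst_data p)) (fst_data (snd_data (fst_data p))) (p_rec p))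
  (Cons n (Cons G row)) S).

Definition dtable c n G S T := lrec (fun=> Nil)
  (fun p => Cons (drow c (fst_data (fst_data p)) (fst_data (snd_data (fst_data p)))
                   (snd_data (snd_data (fst_data p))) (p_hd p)) (p_rec p))
  (Cons n (Cons G S)) T.

Definition dvar c n s := Cons Nil (Cons (dstate c n s) Nil).

Definition dor f g := Cons (code_nat 3) (Cons f (Cons g Nil)).

(** While counting down from [n], the tail of the counter is itself the code of a state. *)
Definition dsome c n i := lrec
  (fun e => dvar c (fst_data e) (snd_data e))
  (fun p => dor (dvar c (fst_data (fst_data p)) (p_tl p)) (p_rec p))
  (Cons n i) n.

(* At each node, computes both the image of the tree seen as the code of a
   formula and its image seen as the code of a list of formulas. *)
Definition deither n f := fst_data (drec (fun=> Cons Nil Nil)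
  (fun p => let d := fst_data (snd_data p) in let n := fst_data p in
     let list_rest := snd_data (snd_data (snd_data (snd_data p))) in
     Cons (if fst_data d is Cons _ _ then Cons (fst_data d) list_rest
           else dor (dvar true n (fst_data (snd_data d)))
                    (dvar false n (fst_data (snd_data d))))
          (Cons (fst_data (fst_data (snd_data (snd_data p)))) list_rest))
  n f).

Definition dform n i f :=
  dor (Cons (code_nat 1) (Cons (dsome true n i) Nil))
      (Cons (code_nat 2) (Cons (dsome false n i) (Cons (deither n f) Nil))).

Definition dmain x :=
  let S := fst_data x in
  let G := fst_data (snd_data x) in
  let a := fst_data (snd_data (snd_data x)) in
  let n := fst_data a in
  let i := fst_data (snd_data a) in
  let T := fst_data (snd_data (snd_data a)) in
  let f := fst_data (snd_data (snd_data (snd_data a))) in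
  Cons (dcat n n) (Cons (dcat n i)
    (Cons (dcat (dtable true n G S T) (dtable false n G S T))
      (Cons (dform n i f) Nil))).

Section DComputable.
Variable c : bool.

Lemma computable_dstate a b : computable a -> computable b ->
  computable (fun x => dstate c (a x) (b x)).
Proof. by move=> Ha Hb; case: c => //; apply: computable_dcat. Qed.

Lemma computable_dvar a b : computable a -> computable b ->
  computable (fun x => dvar c (a x) (b x)).
Proof. by move=> Ha Hb; rewrite /dvar; comp; apply: computable_dstate. Qed.

Lemma computable_dby a b : computable a -> computable b ->
  computable (fun x => dby c (a x) (b x)).
Proof. by move=> Ha Hb; rewrite /dby; comp. Qed.
End DComputable.

Lemma computable_dpass c a b : computable a -> computable b ->
  computable (fun x => dpass c (a x) (b x)).
Proof.
move=> Ha Hb; apply: computable_dby; rewrite /dlift /datom;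
  comp_with computable_dstate.
Qed.

Lemma computable_dletters c a b d : computable a -> computable b -> computable d ->
  computable (fun x => dletters c (a x) (b x) (d x)).
Proof.
move=> Ha Hb Hd; apply: computable_lrec => //; last by comp.
- comp_with computable_dpass.
- rewrite /p_rec; apply: computable_cons; last apply: computable_dby;
    comp_with computable_dpass.
Qed.

Lemma computable_drow c a b d k :
  computable a -> computable b -> computable d -> computable k ->
  computable (fun x => drow c (a x) (b x) (d x) (k x)).
Proof.
move=> Ha Hb Hd Hk; apply: computable_snd; apply: computable_lrec => //; first by comp.
- rewrite /drow_step /p_rec; apply: computable_cons; last apply: computable_dcat;
    comp_with computable_dletters.
- by comp.
Qed.

Lemma computable_dtable c a b d k :
  computable a -> computable b -> computable d -> computable k ->
  computable (fun x => dtable c (a x) (b x) (d x) (k x)).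
Proof.
move=> Ha Hb Hd Hk; apply: computable_lrec => //; first by comp.
- by rewrite /p_rec /p_hd; comp_with computable_drow.
- by comp.
Qed.

Lemma computable_dsome c a b : computable a -> computable b ->
  computable (fun x => dsome c (a x) (b x)).
Proof.
move=> Ha Hb; apply: computable_lrec => //; last by comp.
- by comp_with computable_dvar.
- by rewrite /dor /p_tl /p_rec; comp_with computable_dvar.
Qed.

Lemma computable_deither a b : computable a -> computable b ->
  computable (fun x => deither (a x) (b x)).
Proof.
move=> Ha Hb; apply: computable_fst; apply: computable_drec => //; first by comp.
by rewrite /dor /=; comp_with computable_dvar.
Qed.

Lemma computable_dform a b d : computable a -> computable b -> computable d ->
  computable (fun x => dform (a x) (b x) (d x)).
Proof.
move=> Ha Hb Hd; rewrite /dform /dor.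
comp_with2 computable_dsome computable_deither.
Qed.

Lemma computable_dmain : computable dmain.
Proof.
apply: computable_cons; first by apply: computable_dcat; comp.
apply: computable_cons; first by apply: computable_dcat; comp.
apply: computable_cons; last by comp_with computable_dform.
by apply: computable_dcat; comp_with computable_dtable.
Qed.

(** * Computation of the automaton *)

Lemma enum_bool_prod (Q : finType) :
  enum {: bool * Q} = map (pair true) (enum Q) ++ map (pair false) (enum Q).
Proof.
have -> : enum {: bool * Q} = prod_enum bool Q by rewrite enumT unlock.
rewrite /prod_enum; have -> : enum {: bool} = [:: true; false] by rewrite enumT unlock.
by rewrite /= cats0.
Qed.

Lemma enum_rank_index (Q : finType) (q : Q) : enum_rank q = index q (enum Q) :> nat.
Proof.
by rewrite -{2}(nth_enum_rank q q) index_uniq ?enum_uniq // -cardE.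
Qed.

Lemma code_state_index (Q : finType) (q : Q) : code_state q = code_nat (index q (enum Q)).
Proof. by rewrite /code_state enum_rank_index. Qed.

Lemma code_state_ctl (Q : finType) c (q : Q) :
  code_state (c, q) = dstate c (code_nat #|Q|) (code_state q).
Proof.
have inj b : injective (@pair bool Q b) by move=> x y [].
rewrite /dstate !code_state_index enum_bool_prod index_cat; case: c.
  by rewrite map_f ?mem_enum // index_map.
rewrite ifN; last by apply/mapP => -[].
by rewrite index_map // size_map -cardE dcat_code_nat.
Qed.

Section Correctness.
Variables (S G : finType) (A : aut (S * G)%type).
Hypotheses (gameA : game_aut A) (G0 : 0 < #|G|).
Let Q := state A.
Let n := code_nat #|Q|.

Definition two_way (e : dl (bool * Q)) := exists qL qR,
  e = And (Atom (dirL, qL)) (Atom (dirR, qR)) \/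
  e = Or (Atom (dirL, qL)) (Atom (dirR, qR)).

Lemma dlift_code c e : two_way e -> dlift c n (code_dl e) = code_dl (dl_map (set_ctl c) e).
Proof.
case=> qL [qR [->|->]] /=; rewrite /dlift /datom /=; congr (Cons _ (Cons _ (Cons _ _)));
  by rewrite ?code_state_ctl.
Qed.

Lemma dby_code c (e1 e2 : dl (bool * (bool * Q))) :
  dby c (code_dl e1) (code_dl e2) = code_dl (by_player c e1 e2).
Proof. by case: c. Qed.

Lemma dpass_code c e : two_way e -> dpass c n (code_dl e) = code_dl (pass c e).
Proof. by move=> He; rewrite /dpass !dlift_code // dby_code. Qed.

(** Induction on the number [k] of letters read; [r] is the part of the row for later letters of
    [S]. *)
Lemma dletters_code c d0 k (s : seq (dl (bool * Q))) r :
  (forall i, i < size s -> two_way (nth d0 s i)) -> 0 < size s -> k <= size s ->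
  dletters c n (code_nat k) (code_seq (map (@code_dl _) s ++ r)) =
    Cons (code_seq (drop k (map (@code_dl _) s ++ r)))
      (code_dl (foldl (fun acc e => by_player c (pass c e) acc)
                 (pass c (head d0 s)) (take k s))).
Proof.
move=> Hs s0; rewrite /dletters; elim: k => [_|k IHk ks].
  rewrite drop0 take0 /= -dpass_code; first by case: s Hs s0 => // e s.
  by rewrite -nth0; apply: Hs.
rewrite [code_nat _]/= /= -/(code_nat k) IHk ?(ltnW ks) // /p_rec /=.
have ks' : k < size (map (@code_dl Q) s ++ r) by rewrite size_cat size_map ltn_addr.
rewrite (drop_nth Nil ks') /= (take_nth d0 ks) foldl_rcons.
rewrite nth_cat size_map ks (nth_map d0) // dpass_code ?dby_code //; exact: Hs.
Qed.

(** A row is a concatenation of blocks of length [#|G|], one per letter of [S]; each turn of the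
    loop consumes a block. *)
Lemma drow_code c q :
  drow c n (code_nat #|G|) (code_nat #|S|)
    (code_seq [seq code_dl (trans q x) | x <- [seq (a, b) | a <- enum S, b <- enum G]]) =
  code_seq [seq code_dl (ctl_trans (A := A) (c, q) a) | a <- enum S].
Proof.
pose chunk a := [seq trans q (a, b) | b <- enum G].
pose d0 : dl (bool * Q) := Atom (false, q).
have chunk_size a : size (chunk a) = #|G| by rewrite size_map cardE.
have [b0 _] := card_gt0P G0.
pose codes a := map (@code_dl Q) (chunk a).
have -> : [seq code_dl (trans q x) | x <- [seq (a, b) | a <- enum S, b <- enum G]] =
    flatten [seq codes a | a <- enum S].
  rewrite map_flatten -map_comp; congr flatten; apply: eq_map => a /=.
  by rewrite /codes /chunk -!map_comp.
suff H (k : nat) : k <= #|S| -> lrec (fun e => Cons (snd_data (snd_data e)) Nil)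
    (fun p => drow_step c (fst_data (fst_data p)) (fst_data (snd_data (fst_data p))) (p_rec p))
    (Cons n (Cons (code_nat #|G|) (code_seq (flatten [seq codes a | a <- enum S]))))
    (code_nat k) =
  Cons (code_seq (flatten [seq codes a | a <- drop k (enum S)]))
       (code_seq [seq code_dl (ctl_trans (A := A) (c, q) a) | a <- take k (enum S)]).
  by rewrite /drow H //= take_oversize // cardE.
elim: k => [|k IHk] kS; first by rewrite drop0 take0.
have [a0 Ea] : exists a0, drop k (enum S) = a0 :: drop k.+1 (enum S).
  case E : (enum S) => [|a1 s']; first by move: kS; rewrite cardE E.
  by exists (nth a1 (enum S) k); rewrite -E; apply: drop_nth; rewrite -cardE.
have Es : take k.+1 (enum S) = rcons (take k (enum S)) a0.
  have -> : a0 = nth a0 (enum S) k by rewrite -[k in RHS]addn0 -nth_drop Ea.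
  by apply: take_nth; rewrite -cardE.
rewrite Es map_rcons; move: {Es} (drop k.+1 _) Ea => s' Ea.
rewrite [code_nat _]/= /= -/(code_nat k) IHk ?(ltnW kS) // /p_rec /drow_step /= Ea /=.
rewrite (@dletters_code c d0 #|G| (chunk a0)) ?chunk_size //.
  rewrite drop_size_cat; last by rewrite size_map chunk_size.
  by rewrite /= -(chunk_size a0) take_size -cats1 -dcat_code_seq.
move=> i iG; rewrite (nth_map b0) -?cardE //; exact: gameA.
Qed.

Definition in_row (q : Q) := code_seq [seq code_dl (trans q x)
  | x <- [seq (a, b) | a <- enum S, b <- enum G]].

Definition out_row (x : bool * Q) := code_seq [seq code_dl (ctl_trans (A := A) x a) | a <- enum S].

Lemma dtable_code c :
  dtable c n (code_nat #|G|) (code_nat #|S|) (code_seq (map in_row (enum Q))) =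
  code_seq [seq out_row (c, q) | q <- enum Q].
Proof.
elim: (enum (state A)) => //= q s <-.
by rewrite /dtable /= /p_hd /p_rec /= {2}/in_row drow_code.
Qed.

Lemma dvar_code c (q : Q) : dvar c n (code_state q) = code_bform (BVar (c, q)).
Proof. by rewrite /= code_state_ctl. Qed.

Lemma dsome_code c : dsome c n (code_state (init A)) = code_bform (some_ctl (init A) c).
Proof.
suff H (k : nat) : k <= #|Q| -> lrec
    (fun e => dvar c (fst_data e) (snd_data e))
    (fun p => dor (dvar c (fst_data (fst_data p)) (p_tl p)) (p_rec p))
    (Cons n (code_state (init A))) (code_nat k) =
  code_bform (foldl (fun f q => BOr (BVar (c, q)) f) (BVar (c, init A)) (take k (enum Q))).
  by rewrite /dsome H // /some_ctl take_oversize // -cardE.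
elim: k => [_|k IHk kQ]; first by rewrite take0 /= dvar_code.
rewrite [code_nat _]/= /= -/(code_nat k) IHk ?(ltnW kQ) // /p_rec /p_tl /=.
rewrite (take_nth (init A)) -?cardE // foldl_rcons /= code_state_ctl code_state_index.
by rewrite index_uniq ?enum_uniq -?cardE.
Qed.

Lemma deither_code (phi : bform Q) : deither n (code_bform phi) = code_bform (either_ctl phi).
Proof.
rewrite /deither; elim: phi => [q|f IHf|f IHf g IHg|f IHf g IHg].
- by rewrite /= !dvar_code.
- by rewrite /= IHf.
- by rewrite /= IHf IHg.
- by rewrite /= IHf IHg.
Qed.

Lemma dmain_code (phi : bform Q) : dmain (code_input phi) = code_output (ctl_form phi).
Proof.
rewrite /dmain /code_input /code_output /code_aut /= -/n.
rewrite dcat_code_nat card_prod card_bool mul2n addnn.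
rewrite !dtable_code dcat_code_seq.
rewrite -[dcat n _](code_state_ctl false) enum_bool_prod map_cat -!map_comp.
by rewrite /dform !dsome_code deither_code.
Qed.

End Correctness.

(** * Regularity, effective construction and size bound *)

Theorem theorem6p1 :
  exists (P : prog) (p : {poly nat}),
    forall (S G : finType) (A : aut (S * G)%type),
      0 < #|G| -> game_aut A ->
      regular (forall_star (lang A)) /\
      forall phi : bform (state A), describes phi (acc A) ->
        exists (B : aut S) (psi : bform (state B)),
          [/\ describes psi (acc B),
              run P (code_input phi) (code_output psi),
              lang B = forall_star (lang A),
              graph_size B <= (p.[graph_size A])%R
            & aut_size psi <= (p.[aut_size phi])%R].
Proof.
have [P HP] := computable_dmain.
(* The graph costs a factor 10; 4 more absorbs the term of the formula linear in the number of
   states, and its factor 8 on [phi] is below 14. *)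
exists P, ('X *+ 14)%R => S G A G0 gameA.
have pE m : (('X *+ 14 : {poly nat}).[m])%R = 14 * m.
  by rewrite hornerMn hornerX -GRing.mulr_natl.
split; first by exists (ctl_aut A); exact: lang_ctl_aut.
move=> phi Hphi; exists (ctl_aut A), (ctl_form phi); rewrite !pE.
have Hg := graph_size_ctl_aut gameA G0.
split.
- exact: describes_ctl_form.
- by rewrite -dmain_code.
- exact: lang_ctl_aut.
- by rewrite (leq_trans Hg) // leq_mul2r orbT.
- have Hf := bform_size_ctl_form phi; rewrite /aut_size mulnDr.
  have HQ : #|state A| <= graph_size A by exact: leq_addr.
  move: Hf Hg HQ; set a := bform_size phi; set b := bform_size _.
  set c := graph_size _; set d := graph_size _; set e := #|_|; lia.
Qed.
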